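(* For any non-zero countable ordinal $\alpha$, $\mathbb{N}\langle\alpha+1\rangle \in \mathsf{QCB_0}(\mathbf{\Pi}^1_\alpha)\setminus \mathsf{QCB_0}(\mathbf{\Sigma}^1_\alpha)$. For any countable limit ordinal $\lambda$, $\mathbb{N}\langle\lambda\rangle \in \mathsf{QCB_0}((\mathbf{\Pi}^1_{<\lambda})_\delta)\setminus \mathsf{QCB_0}((\mathbf{\Sigma}^1_{<\lambda})_\sigma)$.
   Context: For a representation $\delta$ (a surjection from a subspace of the Baire space $\mathcal{N}$ onto $X$), $\mathit{EQ}(\delta)=\{(p,q)\mid p,q\in\mathit{dom}(\delta),\ \delta(p)=\delta(q)\}$. For a family of pointclasses $\mathbf{\Gamma}$, $\mathsf{QCB_0}(\mathbf{\Gamma})$ is the class of spaces having an admissible representation $\delta$ with $\mathit{EQ}(\delta)\in\mathbf{\Gamma}(\mathcal{N}^2)$. $\mathbf{\Sigma}^1_\alpha$ are the levels of the hyperprojective hierarchy ($\mathbf{\Sigma}^1_0=\mathbf{\Sigma}^0_2$; successor: projections along $\mathcal{N}$ of complements; limit $\lambda$: projections along $\mathcal{N}$ of countable intersections of sets in lower levels), $\mathbf{\Pi}^1_\alpha$ their complements, $\mathbf{\Sigma}^1_{<\lambda}=\bigcup_{\alpha<\lambda}\mathbf{\Sigma}^1_\alpha$, $\mathbf{\Pi}^1_{<\lambda}$ likewise, and subscripts $\delta$, $\sigma$ denote closure under countable intersections, resp. unions. The spaces are defined in the category $\mathsf{QCB_0}$ of qcb$_0$-spaces by $\mathbb{N}\langle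 0\rangle:=\omega$ (discrete), $\mathbb{N}\langle\alpha+1\rangle:=\omega^{\mathbb{N}\langle\alpha\rangle}$ ($\mathsf{QCB_0}$-exponential), $\mathbb{N}\langle\lambda\rangle:=\prod_{\alpha<\lambda}\mathbb{N}\langle\alpha\rangle$ ($\mathsf{QCB_0}$-product) for countable limit $\lambda$. *)

(* Defs.v *)
From HB Require Import structures.
From mathcomp Require Import all_boot all_order.
From mathcomp Require Import boolp classical_sets functions cardinality.
From mathcomp Require Import topology separation_axioms borel_hierarchy.

Set Implicit Arguments.
Unset Strict Implicit.
Unset Printing Implicit Defensive.

Import Order.TTheory.
Local Open Scope classical_set_scope.

(* Ordinals are the elements of an arbitrary well-ordered type [W]: [a : W]
   stands for the order type of its initial segment [set b | b < a]. *)
Section Ordinals.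
Context {d : Order.disp_t} {W : orderType d}.
Implicit Types a b c : W.

Definition ord_countable a := countable [set b : W | (b < a)%O].

Definition ord_zero a := forall b, (a <= b)%O.

(* b = a + 1 *)
Definition ord_succ a b := (a < b)%O /\ forall c, (a < c)%O -> (b <= c)%O.

Definition ord_limit a :=
  ~ ord_zero a /\ forall b, (b < a)%O -> exists2 c, (b < c)%O & (c < a)%O.

End Ordinals.

Definition baire_space : Type := prod_topology (fun _ : nat => nat).

HB.instance Definition _ := Topological.on baire_space.

Definition pointclass := forall T : topologicalType, set T -> Prop.

Definition co_class (G : pointclass) : pointclass := fun T A => G T (~` A).

Definition delta_class (G : pointclass) : pointclass := fun T A =>
  exists2 B : nat -> set T, (forall n, G T (B n)) & A = \bigcap_n B n.

Definition sigma_class (G : pointclass) : pointclass := fun T A =>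
  exists2 B : nat -> set T, (forall n, G T (B n)) & A = \bigcup_n B n.

Section HyperprojectiveHierarchy.
Context {d : Order.disp_t} {W : orderType d}.

(* These classes are only used on the spaces N^k (N the Baire space), which are
   metrizable, so that Sigma^0_2 is the class of F_sigma sets. Being inductive,
   the predicate is the least family closed under the clauses; since [W] is
   well-founded and the clauses exclude each other, it is the only one. *)
Inductive hyp_Sigma (a : W) (T : topologicalType) (A : set T) : Prop :=
| hyp_Sigma_zero of ord_zero a & Fsigma A
| hyp_Sigma_succ (b : W) (B : set (T * baire_space)%type) of
    ord_succ b a & hyp_Sigma b B & A = fst @` (~` B)
| hyp_Sigma_limit (b : nat -> W) (B : nat -> set (T * baire_space)%type) of
    ord_limit a & (forall n, (b n < a)%O) & (forall n, hyp_Sigma (b n) (B n))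
    & A = fst @` (\bigcap_n B n).

Definition Sigma1 (a : W) : pointclass := fun T A => hyp_Sigma a A.

Definition Pi1 (a : W) : pointclass := co_class (Sigma1 a).

Definition Sigma1_lt (l : W) : pointclass := fun T A =>
  exists2 a : W, (a < l)%O & Sigma1 a A.

Definition Pi1_lt (l : W) : pointclass := fun T A =>
  exists2 a : W, (a < l)%O & Pi1 a A.

End HyperprojectiveHierarchy.

(* [set_type D] carries the subspace topology. *)
Definition admissible_representation (X : topologicalType)
    (D : set baire_space) (delta : set_type D -> X) : Prop :=
  [/\ continuous delta,
      (forall x, exists p, delta p = x) &
      forall (E : set baire_space) (phi : set_type E -> X), continuous phi ->
        exists2 g : set_type E -> set_type D,
          continuous g & phi = delta \o g].

Definition EQ (X : Type) (D : set baire_space) (delta : set_type D -> X) :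
    set (baire_space * baire_space)%type :=
  [set pq | exists p q : set_type D,
    [/\ set_val p = pq.1, set_val q = pq.2 & delta p = delta q]].

Definition QCB0_class (G : pointclass) (X : topologicalType) : Prop :=
  exists (D : set baire_space) (delta : set_type D -> X),
    admissible_representation delta /\ G _ (EQ delta).

Definition qcb0 (X : topologicalType) : Prop :=
  kolmogorov_space X /\
  exists (Y : topologicalType) (q : Y -> X),
    [/\ @second_countable Y, (forall x, exists y, q y = x) &
        forall A : set X, open A <-> open (q @^-1` A)].

(* The objects of the category QCB_0 are the spaces satisfying [qcb0] and its
   morphisms are all continuous functions; products and exponentials are given
   by their universal properties in that category. In general their topologies
   differ from the product topology and from the compact-open topology. *)

Definition qcb0_product (I : Type) (X : I -> topologicalType)
    (P : topologicalType) (pr : forall i, P -> X i) : Prop :=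
  [/\ qcb0 P, (forall i, continuous (pr i)) &
      forall (Z : topologicalType) (f : forall i, Z -> X i),
        qcb0 Z -> (forall i, continuous (f i)) ->
        exists! h : Z -> P, continuous h /\ forall i, pr i \o h = f i].

Definition qcb0_product2 (X1 X2 P : topologicalType)
    (pr1 : P -> X1) (pr2 : P -> X2) : Prop :=
  [/\ qcb0 P, continuous pr1, continuous pr2 &
      forall (Z : topologicalType) (f1 : Z -> X1) (f2 : Z -> X2),
        qcb0 Z -> continuous f1 -> continuous f2 ->
        exists! h : Z -> P,
          [/\ continuous h, pr1 \o h = f1 & pr2 \o h = f2]].

(* [E] is an exponential Y^X, with evaluation map [ev : E x X -> Y]. The map
   [k] below is [g x id : Z x X -> E x X]. *)
Definition qcb0_exponential (Y X E : topologicalType) : Prop :=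
  qcb0 E /\
  exists (P : topologicalType) (pr1 : P -> E) (pr2 : P -> X) (ev : P -> Y),
  [/\ qcb0_product2 pr1 pr2, continuous ev &
      forall (Z Q : topologicalType) (q1 : Q -> Z) (q2 : Q -> X) (f : Q -> Y),
        qcb0 Z -> qcb0_product2 q1 q2 -> continuous f ->
        exists! g : Z -> E, continuous g /\
          exists k : Q -> P, [/\ continuous k, pr1 \o k = g \o q1,
            pr2 \o k = q2 & ev \o k = f]].

(* [N_space a X]: the space [X] is N<a>, which is determined up to
   homeomorphism. The topology of [nat] is discrete. *)
Inductive N_space {d : Order.disp_t} {W : orderType d} (a : W) :
    topologicalType -> Prop :=
| N_space_zero : ord_zero a -> N_space a nat
| N_space_succ (b : W) (Y X : topologicalType) :
    ord_succ b a -> N_space b Y -> qcb0_exponential nat Y X -> N_space a X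
| N_space_limit (F : {b : W | (b < a)%O} -> topologicalType)
    (X : topologicalType) (pr : forall b, X -> F b) :
    ord_limit a -> (forall b, N_space (sval b) (F b)) ->
    qcb0_product pr -> N_space a X.

(* Main.v *)
Require Import Defs.
From HB Require Import structures.
From mathcomp Require Import all_boot all_order.
From mathcomp Require Import boolp classical_sets functions cardinality.
From mathcomp Require Import topology separation_axioms borel_hierarchy.

(* Upper bound. If Y has an admissible representation, so does nat^Y: name a
   continuous function by an associate, i.e. by its values on finite prefixes of
   names of points. The final topology of this representation makes the
   sets of functions constant on a convergent sequence open, which gives joint
   continuity of continuous families of functions and hence admissibility.
   Two associates name the same function iff they agree at all equivalent names
   of points of Y, so the complement of the equality relation of nat^Y is the
   projection of the intersection of that of Y with a closed set. Countable
   products intersect countably many equality relations.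

   Lower bound. Every Pi^1_a subset A of the Baire space is a continuous image of
   a zero set of N<a+1> (and similarly at limits). If A is the complement of the
   projection of a set that is the image of a zero set C of Y, then p belongs to A
   iff, for every y in Y, there is a place n witnessing that y is not in C or is
   not above p; so p is in A iff "the first such n" is a total, hence continuous,
   function of y, and the pairs of p and this function form a zero set of
   nat^Y. If the equality relation of some admissible representation of N<a+1>
   were Sigma^1_a, so would be its domain and all continuous images of
   relatively closed subsets of the domain, hence all Pi^1_a sets, which a
   universal set refutes. *)

Set Implicit Arguments.
Unset Strict Implicit.
Unset Printing Implicit Defensive.

Import Order.TTheory.
Local Open Scope classical_set_scope.

(** * The Baire space *)

Definition agree (n : nat) (p q : baire_space) := forall i, i < n -> q i = p i.

Lemma nat_nbhs (n : nat) (A : set nat) : nbhs n A = A n.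
Proof.
rewrite nbhs_principalE propeqE; split; first by move/principal_filterP.
by move=> An; apply/principal_filterP.
Qed.

Lemma nat_continuous (T : topologicalType) (f : T -> nat) :
  continuous f <-> forall t, \forall t' \near t, f t' = f t.
Proof.
split=> [cf t|near_f t]; last exact: (near_cst_continuous (f t) (near_f t)).
by have := cf t [set f t]; rewrite nat_nbhs; exact.
Qed.

Lemma baire_eval_continuous (n : nat) : continuous (fun p : baire_space => p n).
Proof. exact: (@proj_continuous nat (fun=> nat : topologicalType) n). Qed.

Lemma agree_nbhs (n : nat) (p : baire_space) : nbhs p (agree n p).
Proof.
elim: n => [|n IHn]; first exact: (@filterE _ _ (nbhs_filter p)).
have := (nat_continuous (fun p : baire_space => p n)).1
  (@baire_eval_continuous n) p.
apply: (@filterS2 _ _ (nbhs_filter p) _ _ _ _ IHn) => q Hq qn i.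
by rewrite ltnS leq_eqVlt => /orP[/eqP->//|]; exact: Hq.
Qed.

Lemma baire_nbhs (p : baire_space) (A : set baire_space) :
  nbhs p A <-> exists n, agree n p `<=` A.
Proof.
split=> [|[n nA]]; last by apply: filterS nA _; exact: agree_nbhs.
(* The product topology is a supremum of initial topologies, so it is enough that the filter
   generated by the sets [agree n p] converges to [p] in each coordinate. *)
pose F := filter_from setT (fun n => agree n p).
have FF : Filter F.
  apply: filter_from_filter => [|i j _ _]; first by exists 0.
  exists (maxn i j) => // q Hq; split=> k kl; apply: Hq.
    by rewrite leq_max kl.
  by rewrite leq_max kl orbT.
suff Fp : F --> p by move=> /Fp[n _ nA]; exists n.
apply/cvg_sup => n; apply/cvg_image.
  rewrite eqEsubset; split=> // k _; exists (fun=> k) => //.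
move=> B nB; exists (fun q : baire_space => B (q n)).
  exists n.+1 => // q Hq; rewrite /= Hq //.
  by move: nB; rewrite nat_nbhs.
rewrite eqEsubset; split=> [_ [q Bq <-]//|k Bk].
by exists (fun=> k).
Qed.

Lemma baire_continuous (T : topologicalType) (f : T -> baire_space) :
  continuous f <-> forall n, continuous (fun t => f t n).
Proof.
split=> [cf n t|cf t A /baire_nbhs[n nA]].
  exact: (cvg_comp f (fun p : baire_space => p n) (cf t)
    (@baire_eval_continuous n (f t))).
apply: (filterS (P := fun t' => agree n (f t) (f t'))) => [t' Ht'|]; first exact: nA.
elim: n {A nA} => [|n IHn]; first by apply: nearW => q i.
have := (nat_continuous _).1 (cf n) t.
apply: filterS2 IHn => q Hq qn i; rewrite ltnS leq_eqVlt => /orP[/eqP->//|].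
exact: Hq.
Qed.

Lemma continuous_agree (T : topologicalType) (f : T -> baire_space) n t :
  continuous f -> \forall t' \near t, agree n (f t) (f t').
Proof. by move=> cf; exact: (cf t _ (agree_nbhs n (f t))). Qed.

Lemma sub_val_continuous (D : set baire_space) :
  continuous (set_val : set_type D -> baire_space).
Proof. exact: initial_continuous. Qed.

Lemma sub_nbhs (D : set baire_space) (p : set_type D) (A : set (set_type D)) :
  nbhs p A <-> exists n, forall q : set_type D,
    agree n (set_val p) (set_val q) -> A q.
Proof.
split=> [|[n nA]]; last first.
  apply: (filterS (P := fun q : set_type D => agree n (set_val p) (set_val q))) => //.
  exact: (continuous_agree n p (@sub_val_continuous D)).
rewrite nbhsE => -[_ [[U oU <-]] Up UA].
have /baire_nbhs[n nU] : nbhs (set_val p) U by rewrite nbhsE; exists U.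
by exists n => q /nU Uq; apply: UA.
Qed.

Lemma sub_continuous (D : set baire_space) (T : topologicalType)
    (f : T -> set_type D) :
  continuous (fun t => set_val (f t)) -> continuous f.
Proof.
move=> cf t A /sub_nbhs[n nA].
by apply: filterS (continuous_agree n t cf) => t' /nA.
Qed.

Lemma pair_continuous (T U V : topologicalType) (f : T -> U) (g : T -> V) :
  continuous f -> continuous g -> continuous (fun t => (f t, g t)).
Proof. by move=> cf cg t; apply: cvg_pair; [exact: cf|exact: cg]. Qed.

Lemma comp_continuous (T U V : topologicalType) (g : U -> V) (f : T -> U) :
  continuous f -> continuous g -> continuous (fun t => g (f t)).
Proof. by move=> cf cg t; apply: (cvg_comp f g (cf t)); exact: cg. Qed.

Lemma fst_continuous (T U : topologicalType) : continuous (fst : T * U -> T).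
Proof. by move=> t; exact: cvg_fst. Qed.

Lemma snd_continuous (T U : topologicalType) : continuous (snd : T * U -> U).
Proof. by move=> t; exact: cvg_snd. Qed.

Lemma id_continuous (T : topologicalType) : continuous (fun t : T => t).
Proof. by move=> t; exact: cvg_id. Qed.

(** * Coding pairs and sequences of points by single points *)

Definition npair (m n : nat) : nat := pickle (m, n).
Definition nunpair (k : nat) : nat * nat := odflt (0, 0) (unpickle k).

Lemma npairK m n : nunpair (npair m n) = (m, n).
Proof. by rewrite /nunpair /npair pickleK. Qed.

Definition interleave (P : nat -> baire_space) : baire_space :=
  fun k => P (nunpair k).1 (nunpair k).2.
Definition column (m : nat) (p : baire_space) : baire_space :=
  fun i => p (npair m i).

Lemma interleaveK P m : column m (interleave P) = P m.
Proof. by apply/funext => i; rewrite /column /interleave npairK. Qed.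

Definition pairB (x y : baire_space) : baire_space :=
  interleave (fun m => if m is 0 then x else y).

Lemma column0_pairB x y : column 0 (pairB x y) = x.
Proof. exact: interleaveK. Qed.

Lemma column1_pairB x y : column 1 (pairB x y) = y.
Proof. exact: interleaveK. Qed.

Lemma interleave_continuous (T : topologicalType) (f : nat -> T -> baire_space) :
  (forall m, continuous (f m)) -> continuous (fun t => interleave (fun m => f m t)).
Proof.
by move=> cf; apply/baire_continuous => n; exact: (baire_continuous _).1 (cf _) _.
Qed.

Lemma column_continuous m : continuous (column m).
Proof. by apply/baire_continuous => n; exact: baire_eval_continuous. Qed.

Lemma pairB_continuous (T : topologicalType) (f g : T -> baire_space) :
  continuous f -> continuous g -> continuous (fun t => pairB (f t) (g t)).
Proof.
move=> cf cg.
by apply: (interleave_continuous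
  (f := fun m t => if m is 0 then f t else g t)) => -[].
Qed.

Definition shift (p : baire_space) : baire_space := fun n => p n.+1.
Definition bcons (n : nat) (p : baire_space) : baire_space :=
  fun k => if k is k'.+1 then p k' else n.

Lemma shift_continuous : continuous shift.
Proof. by apply/baire_continuous => n; exact: baire_eval_continuous. Qed.

(** * F-sigma sets and clopen bases *)

Section Fsigma_sets.
Context {T : topologicalType}.
Implicit Types A B D : set T.

Lemma Fsigma_bigcup (A : nat -> set T) :
  (forall n, Fsigma (A n)) -> Fsigma (\bigcup_n A n).
Proof.
move=> FA; have /choice[F HF] : forall n, exists F : nat -> set T,
    (forall i, closed (F i)) /\ A n = \bigcup_i F i.
  by move=> n; have [F clF ->] := FA n; exists F.
exists (fun k => F (nunpair k).1 (nunpair k).2) => [k|]; first exact: (HF _).1.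
apply/seteqP; split=> [x [n _]|x [k _ Fx]].
  by rewrite (HF n).2 => -[i _ Fx]; exists (npair n i) => //; rewrite npairK.
by exists (nunpair k).1 => //; rewrite (HF _).2; exists (nunpair k).2.
Qed.

Lemma FsigmaI A B : Fsigma A -> Fsigma B -> Fsigma (A `&` B).
Proof.
move=> [F clF ->] [G clG ->].
exists (fun k => F (nunpair k).1 `&` G (nunpair k).2) => [k|]; first exact: closedI.
apply/seteqP; split=> [x [[m _ Fx] [n _ Gx]]|x [k _ [Fx Gx]]].
  by exists (npair m n) => //; rewrite npairK.
by split; [exists (nunpair k).1|exists (nunpair k).2].
Qed.

Lemma FsigmaU A B : Fsigma A -> Fsigma B -> Fsigma (A `|` B).
Proof.
move=> FA FB.
have -> : A `|` B = \bigcup_n (if n is 0 then A else B).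
  apply/seteqP; split=> [x [Ax|Bx]|x [[|n] _ Hx]]; [by exists 0|by exists 1| |].
    by left.
  by right.
by apply: Fsigma_bigcup => -[].
Qed.

Lemma Fsigma_preimage (S : topologicalType) (f : S -> T) A :
  continuous f -> Fsigma A -> Fsigma (f @^-1` A).
Proof.
move=> cf [F clF ->]; exists (fun n => f @^-1` F n) => [n|].
  by move/continuous_closedP: cf; apply.
by rewrite preimage_bigcup.
Qed.

(** The class Delta^0_2. Being closed under complement, it passes through the complement in the
    successor clause of the hierarchy. *)
Definition delta2 D := Fsigma D /\ Fsigma (~` D).

Lemma delta2C D : delta2 D -> delta2 (~` D).
Proof. by move=> [? ?]; split=> //; rewrite setCK. Qed.

Lemma clopen_delta2 D : clopen D -> delta2 D.
Proof.
move=> [oD cD]; split; first exact: closed_Fsigma.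
by apply: closed_Fsigma; exact: open_closedC.
Qed.

End Fsigma_sets.

Lemma delta2_preimage (S T : topologicalType) (f : S -> T) (D : set T) :
  continuous f -> delta2 D -> delta2 (f @^-1` D).
Proof. move=> cf [? ?]; split; first exact: Fsigma_preimage.
by rewrite preimage_setC; exact: Fsigma_preimage.
Qed.

Definition countable_clopen_base (T : topologicalType) :=
  exists V : nat -> set T, (forall n, clopen (V n)) /\
    forall x U, nbhs x U -> exists n, V n x /\ V n `<=` U.

(** [U] is the union of the basic sets inside it. The condition [V n] included in [U] does not
    mention the point, so each term is [V n] or empty, hence closed. *)
Lemma open_Fsigma (T : topologicalType) (U : set T) :
  countable_clopen_base T -> open U -> Fsigma U.
Proof.
move=> [V [clV VP]] oU.
have -> : U = \bigcup_n (V n `&` [set x | V n `<=` U]).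
  apply/seteqP; split=> [x Ux|x [n _ [Vx]]]; last exact.
  have [|n [Vx VU]] := VP x U; first exact: open_nbhs_nbhs.
  by exists n.
apply: Fsigma_bigcup => n; apply: closed_Fsigma.
have [VU|nVU] := pselect (V n `<=` U).
  rewrite (_ : _ `&` _ = V n); first exact: (clV n).2.
  by apply/seteqP; split=> [x []|x].
rewrite (_ : _ `&` _ = set0); first exact: closed0.
by apply/seteqP; split=> [x []|x].
Qed.

Lemma closed_delta2 (T : topologicalType) (D : set T) :
  countable_clopen_base T -> closed D -> delta2 D.
Proof.
move=> bT cD; split; first exact: closed_Fsigma.
by apply: open_Fsigma => //; exact: closed_openC.
Qed.

Definition cylinder (s : seq nat) : set baire_space :=
  [set p | mkseq p (size s) = s].

Lemma cylinder_clopen s : clopen (cylinder s).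
Proof.
pose f (p : baire_space) : nat := mkseq p (size s) == s.
have cf : continuous f.
  apply/nat_continuous => p.
  apply: (@filterS _ _ (nbhs_filter p) _ _ _ (agree_nbhs (size s) p)) => q pq.
  rewrite /f; congr (nat_of_bool (_ == _)); apply/eq_in_map => i.
  by rewrite mem_iota add0n => /andP[_ ils]; rewrite pq.
rewrite (_ : cylinder s = f @^-1` [set 1]).
  apply: preimage_clopen => //; split; last exact: discrete_closed.
  exact: discrete_open.
by apply/seteqP; split=> p; rewrite /f /cylinder /=; case: eqP.
Qed.

Lemma mkseq_agree (p q : baire_space) n : mkseq q n = mkseq p n -> agree n p q.
Proof. by move=> /(congr1 (nth 0 ^~ _)) + i ni => /(_ i); rewrite !nth_mkseq. Qed.

Lemma agree_mkseq (p q : baire_space) n : agree n p q -> mkseq q n = mkseq p n.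
Proof.
by move=> pq; apply/eq_in_map => i; rewrite mem_iota add0n => /andP[_ /pq].
Qed.

Lemma baire_base : countable_clopen_base baire_space.
Proof.
exists (fun k => cylinder (odflt [::] (unpickle k))); split.
  by move=> k; exact: cylinder_clopen.
move=> x U /baire_nbhs[n nU]; exists (pickle (mkseq x n)); rewrite pickleK /=.
rewrite /cylinder /= size_mkseq; split=> // q /= Hq; exact/nU/mkseq_agree.
Qed.

Lemma prod_base (S T : topologicalType) :
  countable_clopen_base S -> countable_clopen_base T ->
  countable_clopen_base (S * T)%type.
Proof.
move=> [V [clV VP]] [U [clU UP]].
exists (fun k => fst @^-1` V (nunpair k).1 `&` snd @^-1` U (nunpair k).2); split=> [k|].
  by apply: clopenI; apply: preimage_clopen => //;
    [exact: fst_continuous|exact: snd_continuous].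
move=> [x y] A [[P Q] /= [Px Qy] PQA].
have [m [Vx VP']] := VP _ _ Px; have [n [Uy UQ]] := UP _ _ Qy.
exists (npair m n); rewrite npairK; split=> // -[x' y'] [/= ? ?].
by apply: PQA; split=> /=; [exact: VP'|exact: UQ].
Qed.

(** * Ordinals *)

Section Ordinals.
Context {d : Order.disp_t} {W : orderType d}.
Implicit Types a b c l : W.

Lemma ord_succ_inj a b c : ord_succ b a -> ord_succ c a -> b = c.
Proof.
move=> [ba bP] [ca cP]; case: (ltgtP b c) => // [bc|cb].
  by have := le_lt_trans (bP _ bc) ca; rewrite ltxx.
by have := le_lt_trans (cP _ cb) ba; rewrite ltxx.
Qed.

Lemma ord_zero_succ a b : ord_zero a -> ord_succ b a -> False.
Proof. by move=> a0 [ba _]; have := lt_le_trans ba (a0 b); rewrite ltxx. Qed.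

Lemma ord_limit_succ a b : ord_limit a -> ord_succ b a -> False.
Proof.
move=> [_ aP] [ba bP]; have [c bc ca] := aP _ ba.
by have := le_lt_trans (bP _ bc) ca; rewrite ltxx.
Qed.

Lemma ord_cases a : [\/ ord_zero a, exists b, ord_succ b a | ord_limit a].
Proof.
have [a0|na0] := pselect (ord_zero a); first by constructor 1.
have [[b Hb]|nb] := pselect (exists b, ord_succ b a); first by constructor 2; exists b.
constructor 3; split=> // b ba; apply: contrapT => Hn; apply: nb; exists b.
split=> // c bc; rewrite leNgt; apply/negP => ca; apply: Hn; by exists c.
Qed.

Lemma ord_gt0 a b : (b < a)%O -> ~ ord_zero a.
Proof. by move=> ba a0; have := lt_le_trans ba (a0 b); rewrite ltxx. Qed.

Lemma ord_countableW a b : (b <= a)%O -> ord_countable a -> ord_countable b.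
Proof.
move=> ba; apply: sub_countable; apply: subset_card_le => c /= cb.
exact: lt_le_trans cb ba.
Qed.

Lemma ord_countable_enum a : ord_countable a -> ~ ord_zero a ->
  exists e : nat -> W, (forall n, (e n < a)%O) /\
    forall b, (b < a)%O -> exists n, e n = b.
Proof.
move=> /countable_injP[f finj] /existsNP[b0 /negP]; rewrite -ltNge => b0a.
(* [e] inverts the injection [f]; a number that [f] does not take below [a] is sent to the default
   [b0], available because [a] is not zero. *)
have /choice[e eP] : forall n, exists b, (b < a)%O /\
    forall c, (c < a)%O -> f c = n -> b = c.
  move=> n; have [[b [ba fb]]|nb] := pselect (exists b, (b < a)%O /\ f b = n).
    exists b; split=> // c ca fc; apply: finj; rewrite ?inE//= ?fc//.
  by exists b0; split=> // c ca fc; case: nb; exists c.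
exists e; split=> [n|b ba]; first exact: (eP n).1.
by exists (f b); exact: (eP _).2.
Qed.

Hypothesis wfW : well_founded (fun x y : W => (x < y)%O).

Lemma ord_min (P : W -> Prop) a : P a -> exists2 b, P b & forall c, P c -> (b <= c)%O.
Proof.
elim/(well_founded_ind wfW): a => a IHa Pa.
have [[c [Pc ca]]|nc] := pselect (exists c, P c /\ (c < a)%O); first exact: (IHa c).
by exists a => // c Pc; rewrite leNgt; apply/negP => ca; apply: nc; exists c.
Qed.

Lemma ord_limit_has_succ l a : ord_limit l -> (a < l)%O ->
  exists2 b, ord_succ a b & (b < l)%O.
Proof.
move=> [_ lP] /lP[c ac cl].
have [b ab bP] := @ord_min (fun b => (a < b)%O) c ac.
by exists b; [split|exact: le_lt_trans (bP _ ac) cl].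
Qed.

Lemma ord_zero_lt a b : ord_zero a -> ~ ord_zero b -> (a < b)%O.
Proof.
move=> a0 b0; rewrite lt_neqAle a0 andbT; apply/eqP => ab.
by apply: b0; rewrite -ab.
Qed.

End Ordinals.

(** * Closure properties of the hyperprojective hierarchy *)

Section Hierarchy.
Context {d : Order.disp_t} {W : orderType d}.
Implicit Types (a b c l : W) (S T : topologicalType).

Lemma hyp_Sigma_zeroE a T (A : set T) : ord_zero a -> hyp_Sigma a A -> Fsigma A.
Proof.
move=> a0 [//|b B /(ord_zero_succ a0)//|b B [/(_ a0)//]].
Qed.

Lemma hyp_Sigma_succE a b T (A : set T) : ord_succ b a -> hyp_Sigma a A ->
  exists2 B : set (T * baire_space)%type, hyp_Sigma b B & A = fst @` (~` B).
Proof.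
move=> ba [/ord_zero_succ/(_ ba)//|c B ca HB ->|c B /ord_limit_succ/(_ ba)//].
by exists B => //; rewrite (ord_succ_inj ba ca).
Qed.

Lemma hyp_Sigma_limitE a T (A : set T) : ord_limit a -> hyp_Sigma a A ->
  exists (b : nat -> W) (B : nat -> set (T * baire_space)%type),
    [/\ forall n, (b n < a)%O, forall n, hyp_Sigma (b n) (B n)
      & A = fst @` (\bigcap_n B n)].
Proof.
move=> la [a0|c B /(ord_limit_succ la)//|b B _ ba HB ->]; first by case: la.1.
by exists b, B.
Qed.

Lemma hyp_Sigma_preimage a T (A : set T) : hyp_Sigma a A ->
  forall S (f : S -> T), continuous f -> hyp_Sigma a (f @^-1` A).
Proof.
(* Pulling a projection back along [f] is projecting the pullback along [f] times the identity. *)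
have cfst S T' (f : S -> T') : continuous f ->
    continuous (fun z : S * baire_space => (f z.1, z.2)).
  move=> cf; apply: pair_continuous; last exact: snd_continuous.
  exact: comp_continuous (@fst_continuous _ _) cf.
elim=> {a T A} [a T A a0 FA|a T A b B ba _ IH ->|a T A b B la bl _ IH ->] S f cf.
- by apply: hyp_Sigma_zero => //; exact: Fsigma_preimage.
- apply: (hyp_Sigma_succ ba (IH _ _ (cfst _ _ _ cf))).
  apply/seteqP; split=> [x [[y z] /= nB fx]|x [[y z] /= nB <-]].
    by exists (x, z) => //=; rewrite -fx.
  by exists (f y, z).
- apply: (hyp_Sigma_limit la bl (fun n => IH n _ _ (cfst _ _ _ cf))).
  apply/seteqP; split=> [x [[y z] /= nB fx]|x [[y z] /= nB <-]].
    by exists (x, z) => //= n _; rewrite /= -fx; exact: nB.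
  by exists (f y, z) => //= n _; exact: nB n I.
Qed.

(** Intersection and union go into one induction because the complement in the successor clause
    exchanges them. *)
Lemma hyp_Sigma_delta2 a T (A : set T) : hyp_Sigma a A ->
  forall D, delta2 D -> hyp_Sigma a (A `&` D) /\ hyp_Sigma a (A `|` D).
Proof.
elim=> {a T A} [a T A a0 FA|a T A b B ba _ IH ->|a T A b B la bl _ IH ->] D dD.
- by split; apply: hyp_Sigma_zero => //; [apply: FsigmaI|apply: FsigmaU] => //; case: dD.
- have dD' : delta2 (fst @^-1` (~` D) : set (T * baire_space)%type).
    by apply: delta2_preimage; [exact: fst_continuous|exact: delta2C].
  split; [apply: (hyp_Sigma_succ ba (IH _ dD').2)|apply: (hyp_Sigma_succ ba (IH _ dD').1)].
    apply/seteqP; split=> [x [[[y z] /= nB <-] Dy]|x [[y z] /= /not_orP[nB nD] <-]].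
      by exists (y, z) => //= -[].
    by split; [exists (y, z)|exact: contrapT].
  apply/seteqP; split=> [x [[[y z] /= nB <-]|Dx]|x [[y z] /= /not_andP[nB|nD] <-]].
  + by exists (y, z) => //= -[].
  + by exists (x, fun=> 0) => //= -[].
  + by left; exists (y, z).
  + by right; exact: contrapT.
- have dD' : delta2 (fst @^-1` D : set (T * baire_space)%type).
    by apply: delta2_preimage => //; exact: fst_continuous.
  split; [apply: (hyp_Sigma_limit la bl (fun n => (IH n _ dD').1))|
          apply: (hyp_Sigma_limit la bl (fun n => (IH n _ dD').2))].
    apply/seteqP; split=> [x [[[y z] /= nB <-] Dy]|x [[y z] /= nB <-]].
      by exists (y, z) => //= n _; split=> //; exact: nB.
    split; last by have [] := nB 0 I.
    by exists (y, z) => //= n _; have [] := nB n I.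
  apply/seteqP; split=> [x [[[y z] /= nB <-]|Dx]|x [[y z] /= nB <-]].
  + by exists (y, z) => //= n _; left; exact: nB.
  + by exists (x, fun=> 0) => //= n _; right.
  + have [Dy|nDy] := pselect (D y); first by right.
    by left; exists (y, z) => //= n _; have [] := nB n I.
Qed.

Lemma hyp_SigmaI a T (A D : set T) : delta2 D -> hyp_Sigma a A -> hyp_Sigma a (A `&` D).
Proof. by move=> dD /hyp_Sigma_delta2/(_ _ dD)[]. Qed.

Lemma hyp_SigmaU a T (A D : set T) : delta2 D -> hyp_Sigma a A -> hyp_Sigma a (A `|` D).
Proof. by move=> dD /hyp_Sigma_delta2/(_ _ dD)[]. Qed.

(** The set is the projection of the cylinder over it; any point of the Baire space serves as
    witness. *)
Lemma Pi1_SigmaS a b T (A : set T) : ord_succ a b -> Pi1 a A -> hyp_Sigma b A.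
Proof.
move=> ab PA; apply: (hyp_Sigma_succ ab (hyp_Sigma_preimage PA (@fst_continuous _ baire_space))).
apply/seteqP; split=> [x Ax|x [[y z] /= nA <-]]; last exact: contrapT.
by exists (x, fun=> 0).
Qed.

Lemma Sigma_Pi1S a b T (A : set T) : ord_succ a b -> hyp_Sigma a A -> Pi1 b A.
Proof. by move=> ab SA; apply: (Pi1_SigmaS ab); rewrite /Pi1/co_class setCK. Qed.

(** Two successive projections become one when both witnesses are stored as columns of a single
    point. *)
Lemma hyp_Sigma_proj a T (A : set (T * baire_space)%type) :
  ~ ord_zero a -> hyp_Sigma a A -> hyp_Sigma a (fst @` A).
Proof.
have cg : continuous (fun z : T * baire_space =>
    ((z.1, column 0 z.2), column 1 z.2)).
  have cc m : continuous (fun z : T * baire_space => column m z.2).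
    exact: comp_continuous (@snd_continuous _ _) (@column_continuous m).
  by do 2!apply: pair_continuous => //; exact: fst_continuous.
move=> na0; have [//|[b ba]|la] := ord_cases a.
- move=> /(hyp_Sigma_succE ba)[B HB ->].
  apply: (hyp_Sigma_succ ba (hyp_Sigma_preimage HB cg)).
  apply/seteqP; split=> [x [_ [[[y z] w] /= nB <-] <-]|x [[y z] /= nB <-]].
    by exists (y, pairB z w) => //=; rewrite column0_pairB column1_pairB.
  by exists (y, column 0 z) => //; exists (y, column 0 z, column 1 z).
- move=> /(hyp_Sigma_limitE la)[b [B [bl HB ->]]].
  apply: (hyp_Sigma_limit la bl (fun n => hyp_Sigma_preimage (HB n) cg)).
  apply/seteqP; split=> [x [_ [[[y z] w] /= nB <-] <-]|x [[y z] /= nB <-]].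
    exists (y, pairB z w) => //= n _ /=.
    by rewrite column0_pairB column1_pairB; exact: nB.
  by exists (y, column 0 z) => //; exists (y, column 0 z, column 1 z) => // n _; exact: nB.
Qed.

(** An F-sigma set is the projection of a closed set: the first value of the witness is the index of
    a closed piece containing the point. The complement of that closed set is open, hence of level
    zero. *)
Lemma hyp_Sigma_zero_succ a b T (A : set T) : countable_clopen_base T ->
  ord_zero a -> ord_succ a b -> hyp_Sigma a A -> hyp_Sigma b A.
Proof.
move=> bT a0 ab /(hyp_Sigma_zeroE a0)[F clF ->].
pose C := [set z : T * baire_space | F (z.2 0) z.1].
suff cC : closed C.
  apply: (hyp_Sigma_succ (B := ~` C) ab).
    apply: hyp_Sigma_zero => //; apply: open_Fsigma; last exact: closed_openC.
    exact: prod_base bT baire_base.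
  rewrite setCK; apply/seteqP; split=> [x [n _ Fx]|x [[y z] /= Cy <-]].
    by exists (x, fun=> n).
  by exists (z 0).
rewrite -[C]setCK; apply: open_closedC; rewrite openE => -[x z] /= nF.
exists (~` F (z 0), agree 1 z) => /=.
  split; last exact: agree_nbhs.
  by apply: open_nbhs_nbhs; split=> //; exact: closed_openC.
by move=> [x' z'] [/= ? zz']; rewrite /C /= zz'.
Qed.

Hypothesis wfW : well_founded (fun x y : W => (x < y)%O).

Lemma delta2_hyp_Sigma a T (D : set T) : delta2 D -> hyp_Sigma a D.
Proof.
elim/(well_founded_ind wfW): a T D => a IH T D dD.
have dD' : delta2 (fst @^-1` D : set (T * baire_space)%type).
  by apply: delta2_preimage => //; exact: fst_continuous.
have [a0|[b ba]|la] := ord_cases a.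
- by apply: hyp_Sigma_zero => //; case: dD.
- apply: (hyp_Sigma_succ ba (IH b ba.1 _ _ (delta2C dD'))); rewrite setCK.
  by apply/seteqP; split=> [x Dx|x [[y z] Dy <-]//]; exists (x, fun=> 0).
- have [b ba] : exists b, (b < a)%O.
    have [z0 _ zP] := @ord_min _ _ wfW (fun=> True) a I.
    exists z0; apply: ord_zero_lt la.1 => c; exact: zP.
  apply: (hyp_Sigma_limit la (fun=> ba) (fun=> IH b ba _ _ dD')).
  apply/seteqP; split=> [x Dx|x [[y z] Dy <-]]; last exact: Dy 0 I.
  by exists (x, fun=> 0).
Qed.

Lemma coordinate_delta2 T (f : T -> baire_space) m n : continuous f ->
  delta2 [set t | f t m = n].
Proof.
move=> cf; apply: clopen_delta2.
have -> : [set t | f t m = n] = (fun t => f t m) @^-1` [set n] by [].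
apply: preimage_clopen; last exact: (baire_continuous f).1 cf m.
by split; [exact: discrete_open|exact: discrete_closed].
Qed.

(** The first value of the witness selects some [A n], and its shift is a witness for that set. *)
Lemma hyp_Sigma_bigcup a T (A : nat -> set T) :
  (forall n, hyp_Sigma a (A n)) -> hyp_Sigma a (\bigcup_n A n).
Proof.
elim/(well_founded_ind wfW): a T A => a IH T A HA.
have [a0|[b ba]|la] := ord_cases a.
- apply: hyp_Sigma_zero => //; apply: Fsigma_bigcup => n.
  exact: hyp_Sigma_zeroE (HA n).
- have /choice[B HB] n : exists B : set (T * baire_space)%type,
      hyp_Sigma b B /\ A n = fst @` (~` B).
    by have [B ? ?] := hyp_Sigma_succE ba (HA n); exists B.
  pose g (z : T * baire_space) := (z.1, shift z.2).
  have cg : continuous g.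
    apply: pair_continuous; first exact: fst_continuous.
    exact: comp_continuous (@snd_continuous _ _) shift_continuous.
  (* The complement of [C] says that the shifted witness avoids [B n] for the selected [n]; [C] is
     again a countable union, so the induction hypothesis bounds its level by [b]. *)
  pose C := \bigcup_n ((g @^-1` B n) `&` [set z | z.2 0 = n]).
  apply: (hyp_Sigma_succ (B := C) ba).
    apply: IH => [|n]; first exact: ba.1.
    apply: hyp_SigmaI; first by apply: coordinate_delta2; exact: snd_continuous.
    exact: hyp_Sigma_preimage (HB n).1 _ _ cg.
  apply/seteqP; split=> [x [n _]|x [[y z] /= nC <-]].
    rewrite (HB n).2 => -[[y z] /= nB <-].
    by exists (y, bcons n z) => //= -[m _ [/= + nm]]; rewrite -nm.
  exists (z 0) => //; rewrite (HB _).2; exists (y, shift z) => //= By.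
  by apply: nC; exists (z 0).
- have /choice[bB HB] n : exists bB : (nat -> W) * (nat -> set (T * baire_space)%type),
      [/\ forall i, (bB.1 i < a)%O, forall i, hyp_Sigma (bB.1 i) (bB.2 i)
      & A n = fst @` (\bigcap_i bB.2 i)].
    by have [b [B ?]] := hyp_Sigma_limitE la (HA n); exists (b, B).
  pose g (z : T * baire_space) := (z.1, shift z.2).
  have cg : continuous g.
    apply: pair_continuous; first exact: fst_continuous.
    exact: comp_continuous (@snd_continuous _ _) shift_continuous.
  (* For [k] coding [(n, i)], [C k] imposes the [i]-th condition of [A n] only on witnesses that
     select [n]. *)
  pose C k := g @^-1` (bB (nunpair k).1).2 (nunpair k).2 `|`
    ~` [set z | z.2 0 = (nunpair k).1].
  apply: (hyp_Sigma_limit (b := fun k => (bB (nunpair k).1).1 (nunpair k).2)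
    (B := C) la).
  + by move=> k; case: (HB (nunpair k).1).
  + move=> k; apply: hyp_SigmaU.
      by apply: delta2C; apply: coordinate_delta2; exact: snd_continuous.
    by apply: hyp_Sigma_preimage => //; case: (HB (nunpair k).1).
  + apply/seteqP; split=> [x [n _]|x [[y z] /= HC <-]].
      have [_ _ ->] := HB n => -[[y z] /= Hz <-].
      exists (y, bcons n z) => //= k _; rewrite /C /=.
      have [<-|ne] := eqVneq n (nunpair k).1; first by left; exact: Hz.
      by right; apply/eqP.
    exists (z 0) => //; have [_ _ ->] := HB (z 0).
    exists (y, shift z) => //= i _.
    by have := HC (npair (z 0) i) I; rewrite /C npairK /= => -[].
Qed.

End Hierarchy.

(** * Universal sets *)

Section Universal.
Context {d : Order.disp_t} {W : orderType d}.
Hypothesis wfW : well_founded (fun x y : W => (x < y)%O).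
Implicit Types (a b c l : W) (S T : topologicalType).

Definition universal a (U : set (baire_space * baire_space)%type) :=
  hyp_Sigma a U /\
  forall A : set baire_space, hyp_Sigma a A -> exists p, A = [set x | U (p, x)].

(** Column [n] of a code lists basic sets whose union is the complement of the [n]-th closed set. *)
Lemma universal_zero a : ord_zero a -> exists U, universal a U.
Proof.
move=> a0; have [V [clV VP]] := baire_base.
(* Index 0 is given to the empty set, so that a code can skip an entry. *)
pose V' k : set baire_space := if k is k'.+1 then V k' else set0.
have clV' k : clopen (V' k).
  by case: k => [|k] //=; split; [exact: open0|exact: closed0].
exists (\bigcup_n \bigcap_m [set z | ~ V' (column n z.1 m) z.2]); split.
  apply: hyp_Sigma_zero => //; apply: Fsigma_bigcup => n; apply: closed_Fsigma.
  apply: closed_bigI => m _.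
  rewrite (_ : [set _ | _] = ~` \bigcup_k
      ([set z | column n z.1 m = k] `&` snd @^-1` (V' k))); last first.
    apply/seteqP; split=> [z nV [k _ [/= <-]]//|z nV Vz]; apply: nV.
    by exists (column n z.1 m).
  apply: open_closedC; apply: bigcup_open => k _; apply: openI.
    have : continuous (fun z : baire_space * baire_space => column n z.1 m).
      apply: ((baire_continuous (fun z : baire_space * baire_space => column n z.1)).1 _ m).
      exact: comp_continuous (@fst_continuous _ _) (@column_continuous n).
    by move/continuousP => /(_ [set k]); apply; exact: discrete_open.
  have /continuousP := @snd_continuous baire_space baire_space.
  by apply; exact: (clV' k).1.
move=> A /(hyp_Sigma_zeroE a0)[F clF ->].
pose P n : baire_space := fun m => if pselect (V m `<=` ~` F n) then m.+1 else 0.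
exists (interleave P); apply/seteqP; split=> [x [n _ Fx]|x [n _ /= Hx]].
  exists n => // m _ /=; rewrite interleaveK /P.
  by case: pselect => [VF|_] /=; [move=> /VF|].
exists n => //; apply: contrapT => nFx.
have [|m [Vx VF]] := VP x (~` F n).
  by apply: open_nbhs_nbhs; split=> //; exact: closed_openC.
by apply: (Hx m I) => /=; rewrite interleaveK /P; case: pselect.
Qed.

Lemma universal_succ a b U : ord_succ b a -> universal b U ->
  exists U', universal a U'.
Proof.
move=> ba [HU UP].
pose g (z : baire_space * baire_space * baire_space) := (z.1.1, pairB z.1.2 z.2).
have cg : continuous g.
  apply: pair_continuous.
    exact: comp_continuous (@fst_continuous _ _) (@fst_continuous _ _).
  apply: pairB_continuous; last exact: snd_continuous.
  exact: comp_continuous (@fst_continuous _ _) (@snd_continuous _ _).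
exists (fst @` (~` (g @^-1` U))); split.
  exact: hyp_Sigma_succ ba (hyp_Sigma_preimage HU cg) erefl.
move=> A /(hyp_Sigma_succE ba)[B HB ->].
(* Decoding pairs turns [B] into a subset of the Baire space, to which the universality of [U]
   applies. *)
have ch : continuous (fun w => (column 0 w, column 1 w)).
  by apply: pair_continuous; exact: column_continuous.
have [p Hp] := UP _ (hyp_Sigma_preimage HB ch).
have BU x y : B (x, y) <-> U (p, pairB x y).
  have := congr1 (fun A : set baire_space => A (pairB x y)) Hp.
  by rewrite /= column0_pairB column1_pairB => ->.
exists p; apply/seteqP; split=> [_ [[x y] /= nB <-]|x [[[p' x'] y] /= nU [pp xx]]].
  by exists (p, x, y) => //= /BU.
by exists (x, y) => //= /BU; rewrite -pp -xx.
Qed.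

(* A code of a set of limit level lists in column 0 the levels of the sets being
   intersected, and in column m + 1 a code of the m-th of these sets. *)
Definition limit_section (U : nat -> set (baire_space * baire_space)%type)
    (m n : nat) : set (baire_space * baire_space)%type :=
  (fun z => (column m.+1 z.1, z.2)) @^-1` U n.

Lemma limit_section_Sigma a U m n :
  hyp_Sigma a (U n) -> hyp_Sigma a (limit_section U m n).
Proof.
move=> HU; apply: hyp_Sigma_preimage => //; apply: pair_continuous.
  exact: comp_continuous (@fst_continuous _ _) (@column_continuous _).
exact: snd_continuous.
Qed.

Lemma universal_limit a (e : nat -> W) U : ord_limit a ->
  (forall n, (e n < a)%O) -> (forall b, (b < a)%O -> exists n, e n = b) ->
  (forall n, universal (e n) (U n)) -> exists U', universal a U'.
Proof.
move=> la ea eP UP.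
pose g (z : baire_space * baire_space * baire_space) := (z.1.1, pairB z.1.2 z.2).
have c1 : continuous (fun z : baire_space * baire_space * baire_space => z.1.1).
  exact: comp_continuous (@fst_continuous _ _) (@fst_continuous _ _).
have cg : continuous g.
  apply: pair_continuous => //.
  apply: pairB_continuous; last exact: snd_continuous.
  exact: comp_continuous (@fst_continuous _ _) (@snd_continuous _ _).
(* The level of the [m]-th set depends on the code, but each [C k] needs a fixed level. For [k]
   coding [(m, n)], the condition is imposed at level [e n] and only on codes that announce index
   [n] for their [m]-th set. *)
pose C k := g @^-1` limit_section U (nunpair k).1 (nunpair k).2 `|`
  ~` [set z | column 0 z.1.1 (nunpair k).1 = (nunpair k).2].
exists (fst @` (\bigcap_k C k)); split.
  apply: (hyp_Sigma_limit (b := fun k => e (nunpair k).2) (B := C) la) => // k.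
  apply: hyp_SigmaU.
    apply: delta2C.
    apply: (coordinate_delta2 (f := fun z : baire_space * baire_space * baire_space =>
      column 0 z.1.1)).
    exact: comp_continuous c1 (@column_continuous _).
  apply: hyp_Sigma_preimage => //; apply: limit_section_Sigma.
  exact: (UP _).1.
move=> A /(hyp_Sigma_limitE la)[b [B [bl HB ->]]].
have ch : continuous (fun w => (column 0 w, column 1 w)).
  by apply: pair_continuous; exact: column_continuous.
have /choice[i iP] m : exists n, e n = b m by exact: eP.
have /choice[q qP] m : exists p, (fun w => (column 0 w, column 1 w)) @^-1` B m =
    [set x | U (i m) (p, x)].
  by have [_] := UP (i m); apply; rewrite iP; exact: (hyp_Sigma_preimage (HB m) ch).
have BU m x y : B m (x, y) <-> U (i m) (q m, pairB x y).
  have := congr1 (fun A : set baire_space => A (pairB x y)) (qP m).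
  by rewrite /= column0_pairB column1_pairB => ->.
exists (interleave (fun m => if m is m'.+1 then q m' else i)).
apply/seteqP; split=> [_ [[x y] /= HBx <-]|x [[[p' x'] y] /= HC [pp xx]]].
  exists (interleave (fun m => if m is m'.+1 then q m' else i), x, y) => //= k _.
  have [ik|ne] := eqVneq (i (nunpair k).1) (nunpair k).2.
    by left; rewrite /g/limit_section/= interleaveK -ik; apply/BU; exact: HBx.
  by right => /=; rewrite interleaveK; apply/eqP.
exists (x, y) => //= m _; apply/BU.
have := HC (npair m (i m)) I; rewrite /C npairK /limit_section /g /= pp xx !interleaveK.
by case.
Qed.

Lemma universal_exists a : ord_countable a -> exists U, universal a U.
Proof.
elim/(well_founded_ind wfW): a => a IH ca; have [a0|[b ba]|la] := ord_cases a.
- exact: universal_zero.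
- have [|U HU] := IH b ba.1; first by apply: ord_countableW ca; exact: ltW ba.1.
  exact: universal_succ ba HU.
- have [e [ea eP]] := ord_countable_enum ca la.1.
  have /choice[U HU] n : exists U, universal (e n) U.
    by apply: IH => //; apply: ord_countableW ca; exact/ltW.
  exact: universal_limit la ea eP HU.
Qed.

Lemma Pi1_not_Sigma1 a : ord_countable a ->
  exists2 A : set baire_space, Pi1 a A & ~ Sigma1 a A.
Proof.
move=> /universal_exists[U [HU UP]]; exists [set x | ~ U (x, x)].
  rewrite /Pi1/co_class/Sigma1 (_ : ~` _ = (fun x => (x, x)) @^-1` U).
    by apply: hyp_Sigma_preimage => //; apply: pair_continuous; exact: id_continuous.
  by apply/seteqP; split=> x /=; [exact: contrapT|move=> ?; exact].
move=> /UP[p /(congr1 (fun A : set baire_space => A p))/= E].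
have nU : ~ U (p, p) by move=> Up; have := Up; rewrite -E.
by apply: (nU); rewrite -E.
Qed.

(** Diagonalization over countable unions: a point [p] is read as a code of countably many sets of
    lower levels, as in the universal set of limit level, and the set consists of the [p] outside
    the union that they code. *)
Lemma delta_Pi1_not_sigma_Sigma1 l : ord_countable l -> ord_limit l ->
  exists2 A : set baire_space, delta_class (Pi1_lt l) A
    & ~ sigma_class (Sigma1_lt l) A.
Proof.
move=> cl ll; have [e [el eP]] := ord_countable_enum cl ll.1.
have /choice[U UP] n : exists U, universal (e n) U.
  by apply: universal_exists; apply: ord_countableW cl; exact/ltW.
pose D k := (fun p => (p, p)) @^-1` limit_section U (nunpair k).1 (nunpair k).2
  `&` [set p | column 0 p (nunpair k).1 = (nunpair k).2].
exists (~` \bigcup_k D k).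
  exists (fun k => ~` D k); last by rewrite setC_bigcup.
  move=> k; exists (e (nunpair k).2); first exact: el.
  rewrite /Pi1/co_class setCK; apply: hyp_SigmaI.
    by apply: coordinate_delta2; exact: column_continuous.
  apply: hyp_Sigma_preimage; first by apply: limit_section_Sigma; exact: (UP _).1.
  by apply: pair_continuous; exact: id_continuous.
move=> [B HB DB].
have /choice[c cP] m : exists c, (c < l)%O /\ hyp_Sigma c (B m).
  by have [c ? ?] := HB m; exists c.
have /choice[i iP] m : exists n, e n = c m by apply: eP; exact: (cP m).1.
have /choice[q qP] m : exists p, B m = [set x | U (i m) (p, x)].
  by have [_] := UP (i m); apply; rewrite iP; exact: (cP m).2.
pose p := interleave (fun m => if m is m'.+1 then q m' else i).
suff E : (\bigcup_k D k) p <-> (\bigcup_m B m) p.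
  have nU : ~ (\bigcup_m B m) p by move=> Hp; have := Hp; rewrite -DB; apply; exact/E.
  by apply: (nU); rewrite -DB => /E.
split=> [[k _ [] ]|[m _ Bm]].
  rewrite /limit_section /= !interleaveK => Up ik.
  by exists (nunpair k).1 => //; rewrite qP /= ik.
exists (npair m (i m)) => //; rewrite /D npairK /limit_section /= !interleaveK.
by split=> //; move: Bm; rewrite qP.
Qed.

End Universal.

(** * Representations of qcb0-spaces *)

Lemma set_type_inj (D : set baire_space) (p q : set_type D) :
  set_val p = set_val q -> p = q.
Proof. exact: val_inj. Qed.

Lemma set_type_exists (D : set baire_space) (p : baire_space) :
  D p -> exists q : set_type D, set_val q = p.
Proof. by move=> Dp; exists (exist _ p (mem_set Dp)). Qed.

Section FinalSpace.
Context (D : set baire_space) (X : Type) (delta : set_type D -> X).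

(* A copy of [X] that remembers [delta], to carry its final topology. *)
Definition final_space : Type := let _ := delta in X.

HB.instance Definition _ := gen_eqMixin final_space.
HB.instance Definition _ := gen_choiceMixin final_space.

Definition final_open (A : set final_space) := open (delta @^-1` A).

Lemma final_openT : final_open setT.
Proof. by rewrite /final_open preimage_setT; exact: openT. Qed.

Lemma final_openI : setI_closed final_open.
Proof. by move=> A B oA oB; rewrite /final_open preimage_setI; exact: openI. Qed.

Lemma final_open_bigU (I : Type) (f : I -> set final_space) :
  (forall i, final_open (f i)) -> final_open (\bigcup_i f i).
Proof.
move=> of_; rewrite /final_open preimage_bigcup; apply: bigcup_open => i _.
exact: of_.
Qed.

HB.instance Definition _ :=
  isOpenTopological.Build final_space final_openT final_openI final_open_bigU.

Lemma final_openE (A : set final_space) : open A = open (delta @^-1` A).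
Proof. by []. Qed.

Lemma final_delta_continuous : continuous (delta : set_type D -> final_space).
Proof. by apply/continuousP. Qed.

End FinalSpace.

Lemma kolmogorov_separated (X : topologicalType) :
  (forall x y : X, x <> y -> exists (Z : topologicalType) (f : X -> Z),
    [/\ kolmogorov_space Z, continuous f & f x <> f y]) ->
  kolmogorov_space X.
Proof.
move=> sep x y /eqP/sep[Z [f [T0Z cf /eqP/T0Z[A HA]]]]; exists (f @^-1` A).
by case: HA => -[/set_mem nA /set_mem nbA]; [left|right]; split;
  apply/mem_set => //; exact: cf.
Qed.

Lemma kolmogorov_nat : kolmogorov_space nat.
Proof.
move=> x y /eqP xy; exists [set x]; left; split; apply/mem_set; last by move=> /= E; exact: xy.
by rewrite nat_nbhs.
Qed.

Lemma kolmogorov_baire : kolmogorov_space baire_space.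
Proof.
apply: kolmogorov_separated => x y xy.
have [n xyn] : exists n, x n <> y n.
  by apply: contrapT => /forallNP H; apply: xy; apply/funext => n; exact: contrapT.
exists nat, (fun p => p n); split=> //; first exact: kolmogorov_nat.
exact: baire_eval_continuous.
Qed.

Lemma kolmogorov_sub (D : set baire_space) : kolmogorov_space (set_type D).
Proof.
apply: kolmogorov_separated => x y xy; exists baire_space, set_val; split.
- exact: kolmogorov_baire.
- exact: sub_val_continuous.
- by move=> /set_type_inj.
Qed.

Lemma kolmogorov_prod (X Y : topologicalType) :
  kolmogorov_space X -> kolmogorov_space Y -> kolmogorov_space (X * Y)%type.
Proof.
move=> T0X T0Y; apply: kolmogorov_separated => -[x y] [x' y'] ne.
have [xx|xx] := pselect (x = x').
  exists Y, snd; split=> //; first exact: snd_continuous.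
  by move=> /= yy; apply: ne; rewrite xx yy.
by exists X, fst; split=> //; exact: fst_continuous.
Qed.

Lemma base_second_countable (T : topologicalType) :
  countable_clopen_base T -> @second_countable T.
Proof.
move=> [V [clV VP]]; exists (range V).
  exact: sub_countable (card_image_le _ _) (countableP _).
split=> [_ [n _ <-]|x A nA]; first exact: (clV n).1.
by have [n [Vx VA]] := VP x A nA; exists (V n) => //; split=> //; exists n.
Qed.

Lemma sub_base (D : set baire_space) : countable_clopen_base (set_type D).
Proof.
have [V [clV VP]] := baire_base; exists (fun n => set_val @^-1` V n); split=> [n|x U].
  by apply: preimage_clopen => //; exact: sub_val_continuous.
move=> /sub_nbhs[n nU].
have [k [Vx VU]] := VP _ _ (agree_nbhs n (set_val x)).
by exists k; split=> // y /VU /nU.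
Qed.

Lemma nat_base : countable_clopen_base nat.
Proof.
exists (fun n => [set n]); split=> [n|x U].
  by split; [exact: discrete_open|exact: discrete_closed].
by rewrite nat_nbhs => Ux; exists x; split=> // _ ->.
Qed.

Lemma qcb0_second_countable (X : topologicalType) :
  kolmogorov_space X -> @second_countable X -> qcb0 X.
Proof.
by move=> T0X sX; split=> //; exists X, id; split=> // x; exists x.
Qed.

Lemma qcb0_nat : qcb0 nat.
Proof.
by apply: qcb0_second_countable;
  [exact: kolmogorov_nat|exact: base_second_countable nat_base].
Qed.

Lemma qcb0_sub_prod (D E : set baire_space) : qcb0 (set_type D * set_type E)%type.
Proof.
apply: qcb0_second_countable.
  by apply: kolmogorov_prod; exact: kolmogorov_sub.
by apply: base_second_countable; apply: prod_base; exact: sub_base.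
Qed.

Lemma qcb0_final (D : set baire_space) (X : Type) (delta : set_type D -> X) :
  (forall x, exists p, delta p = x) -> kolmogorov_space (final_space delta) ->
  qcb0 (final_space delta).
Proof.
move=> sdelta T0; split=> //; exists (set_type D), delta; split=> //.
exact: base_second_countable (sub_base _).
Qed.

Definition quotient_representation (X : topologicalType) (D : set baire_space)
    (phi : set_type D -> X) :=
  [/\ continuous phi, forall x, exists p, phi p = x &
      forall A, open (phi @^-1` A) -> open A].

Lemma quotient_continuous_comp (X Z : topologicalType) (D : set baire_space)
    (phi : set_type D -> X) (f : X -> Z) :
  quotient_representation phi -> continuous (f \o phi) -> continuous f.
Proof.
move=> [_ _ qphi] /continuousP cf; apply/continuousP => A oA.
by apply: qphi; exact: cf.
Qed.

(* A point of a quotient of a second countable space is named by the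
   enumerations of a neighbourhood base of one of its preimages. *)
Lemma qcb0_quotient_representation (X : topologicalType) : qcb0 X ->
  exists (D : set baire_space) (phi : set_type D -> X),
    quotient_representation phi.
Proof.
move=> [T0X [Y [q [[B cB [oB BP]] sq oq]]]].
have cq : continuous q by apply/continuousP => A /oq.
have /countable_injP[b binj] := cB.
(* [V n] is the base set numbered [n], or the whole space if [n] numbers none. *)
have /choice[V VB] n : exists V, open V /\ forall U, B U -> b U = n -> U = V.
  have [[U [BU bU]]|nU] := pselect (exists U, B U /\ b U = n).
    exists U; split=> [|U' BU' bU']; first exact: oB.
    by apply: binj; rewrite ?inE// bU bU'.
  by exists setT; split=> [|U BU bU]; [exact: openT|case: nU; exists U].
have Vbase y A : nbhs y A -> exists n, V n y /\ V n `<=` A.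
  move=> /BP[U [BU Uy] UA]; exists (b U).
  by rewrite -((VB (b U)).2 U BU erefl).
pose names (p : baire_space) y := (forall n, V (p n) y) /\
  forall A, nbhs y A -> exists n, V (p n) `<=` A.
(* A common name puts [q y] and [q y'] into the same neighbourhoods, so the T0 axiom identifies
   them; the choice of [w] below is therefore harmless. *)
have namesU p y y' : names p y -> names p y' -> q y = q y'.
  move=> [py1 py2] [py'1 py'2]; apply: contrapT => /eqP/T0X[A HA].
  case: HA => -[/set_mem nA /set_mem nqA]; apply: nqA.
    by have [n VA] := py2 _ (cq _ _ nA); exact: VA (py'1 n).
  by have [n VA] := py'2 _ (cq _ _ nA); exact: VA (py1 n).
(* Any finite list of basic neighbourhoods of [y] extends to a name: list every [V n] containing [y]
   afterwards, with [n0] in place of the others. *)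
have extend (s : nat -> nat) N y : (forall n, n < N -> V (s n) y) ->
    exists p, (forall n, n < N -> p n = s n) /\ names p y.
  move=> sy; have [n0 [n0y _]] := Vbase y setT filterT.
  exists (fun n => if n < N then s n else
    if pselect (V (n - N) y) then n - N else n0); split=> [n ->//|].
  split=> [n|A /Vbase[n [Vy VA]]].
    by case: ifP => [/sy//|_]; case: pselect.
  exists (N + n); rewrite ltnNge leq_addr /= addKn.
  by case: pselect.
pose E : set baire_space := [set p | exists y, names p y].
have /choice[w wP] (p : set_type E) : exists y, names (set_val p) y.
  exact: set_valP p.
exists E, (q \o w); split.
- move=> p A nA; apply/sub_nbhs.
  have [n VA] := (wP p).2 _ (cq _ _ nA).
  exists n.+1 => p' pp'; rewrite /=; apply: VA; rewrite -(pp' n)//.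
  exact: (wP p').1.
- move=> x; have [y <-] := sq x.
  have [p [_ py]] := extend (fun=> 0) 0 y (fun _ => ltac:(done)).
  have [p' Ep'] := @set_type_exists E p (ex_intro _ y py).
  by exists p'; rewrite /= (namesU _ _ y (wP p'))// Ep'.
- move=> A oA; apply/oq; rewrite openE => y qyA.
  have [p [_ py]] := extend (fun=> 0) 0 y (fun _ => ltac:(done)).
  have [p' Ep'] := @set_type_exists E p (ex_intro _ y py).
  have Ap' : A (q (w p')) by rewrite (namesU _ _ y (wP p'))// Ep'.
  have /sub_nbhs[N NA] : nbhs p' ((q \o w) @^-1` A) by apply: open_nbhs_nbhs.
  rewrite /interior nbhsE.
  (* The first [N] entries of the name already force membership in [A]. Any [z] in the intersection
     of these entries has a name starting with them, so its image is in [A] too. *)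
  exists (\bigcap_(n < N) V (p n)).
  + split; last by move=> n _; exact: py.1.
    elim: N {NA} => [|N IHN]; first by rewrite bigcap_mkord big_ord0; exact: openT.
    rewrite bigcap_mkord big_ord_recr /= -(bigcap_mkord N (fun n => V (p n))); apply: openI => //.
    exact: (VB _).1.
  + move=> z Vz; have [r [rp rz]] := extend p N z Vz.
    have [r' Er'] := @set_type_exists E r (ex_intro _ z rz).
    have : A (q (w r')) by apply: NA => n nN; rewrite Er' Ep' rp.
    by rewrite (namesU _ _ z (wP r'))// Er'.
Qed.

(** Some quotient representation exists, and it factors continuously through the admissible one,
    which hence detects open sets as well. *)
Lemma admissible_quotient (X : topologicalType) (D : set baire_space)
    (delta : set_type D -> X) :
  qcb0 X -> admissible_representation delta -> quotient_representation delta.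
Proof.
move=> /qcb0_quotient_representation[E [phi [cphi sphi qphi]]] [cd sd ad].
split=> // A oA; apply: qphi; have [g cg ->] := ad _ _ cphi.
by rewrite comp_preimage; move/continuousP: cg; apply.
Qed.

(** * Countable products in QCB0 *)

Definition homeomorphic (X Y : topologicalType) (u : X -> Y) (v : Y -> X) :=
  [/\ continuous u, continuous v, cancel u v & cancel v u].

Lemma homeomorphic_representation (X Y : topologicalType) (u : X -> Y) (v : Y -> X)
    (D : set baire_space) (delta : set_type D -> X) :
  homeomorphic u v -> admissible_representation delta ->
  admissible_representation (u \o delta) /\ EQ (u \o delta) = EQ delta.
Proof.
move=> [cu cv uK vK] [cd sd ad]; split.
  split=> [|y|E phi cphi].
  - exact: comp_continuous cd cu.
  - by have [p vp] := sd (v y); exists p; rewrite /= vp vK.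
  - have [g cg vphi] := ad E (v \o phi) (comp_continuous cphi cv).
    exists g => //; apply/funext => m; rewrite /= -[LHS]vK; congr u.
    by have /= := congr1 (fun f : _ -> X => f m) vphi.
apply/seteqP; split=> -[x y] [p [q [px qy pq]]]; exists p, q; split=> //.
  exact: (can_inj uK).
by rewrite /= pq.
Qed.

Section Product.
Context (I : Type) (X : I -> topologicalType) (D : I -> set baire_space)
  (delta : forall i, set_type (D i) -> X i) (c : I -> nat).
Hypothesis qcbX : forall i, qcb0 (X i).
Hypothesis adm_delta : forall i, admissible_representation (delta (i := i)).
Hypothesis c_inj : forall i j, c i = c j -> i = j.

Definition prod_dom : set baire_space := [set p | forall i, D i (column (c i) p)].

Definition prod_comp i (p : set_type prod_dom) : set_type (D i) :=
  exist _ (column (c i) (set_val p)) (mem_set (set_valP p i)).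

Definition prod_rep (p : set_type prod_dom) : forall i, X i :=
  fun i => delta (prod_comp i p).

Definition prod_space : topologicalType := final_space prod_rep.

Definition prod_proj i (f : prod_space) : X i := (f : forall i, X i) i.

Lemma prod_comp_continuous i : continuous (prod_comp i).
Proof.
by apply: sub_continuous; exact: comp_continuous (@sub_val_continuous _)
  (@column_continuous _).
Qed.

Lemma prod_comp_lift (T : topologicalType) (g : forall i, T -> set_type (D i)) :
  (forall i, continuous (g i)) ->
  exists2 h : T -> set_type prod_dom, continuous h &
    forall i t, prod_comp i (h t) = g i t.
Proof.
move=> cg.
(* Columns whose number is no [c i] are filled with zeros; injectivity of [c] makes the remaining
   ones unambiguous. *)
pose P n t : baire_space :=
  if pselect (exists i, c i = n) is left e then set_val (g (sval (cid e)) t)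
  else fun=> 0.
have PE i t : P (c i) t = set_val (g i t).
  rewrite /P; case: pselect => [e|]; last by case; exists i.
  by case: cid => j /= /c_inj ->.
have PD t : prod_dom (interleave (P ^~ t)).
  by move=> i; rewrite interleaveK PE; exact: set_valP.
exists (fun t => exist _ (interleave (P ^~ t)) (mem_set (PD t))).
  apply: sub_continuous; apply: interleave_continuous => n; rewrite /P.
  case: pselect => [e|_]; last exact: cst_continuous.
  exact: comp_continuous (cg _) (@sub_val_continuous _).
by move=> i t; apply: set_type_inj; rewrite -PE; exact: interleaveK.
Qed.

Lemma prod_proj_continuous i : continuous (prod_proj i).
Proof.
apply/continuousP => A oA; rewrite final_openE.
have [cd _ _] := adm_delta i.
by move/continuousP: (comp_continuous (@prod_comp_continuous i) cd); apply.
Qed.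

Lemma prod_rep_surjective (f : prod_space) : exists p, prod_rep p = f.
Proof.
have pP i : {p | delta p = (f : forall i, X i) i}.
  by apply: cid; have [_ sd _] := adm_delta i.
have [h _ hP] := @prod_comp_lift nat (fun i _ => sval (pP i))
  (fun i => @cst_continuous _ _ _).
exists (h 0); apply/functional_extensionality_dep => i.
by rewrite /prod_rep hP; case: (pP i).
Qed.

Lemma prod_rep_lift (E : set baire_space) (f : forall i, set_type E -> X i) :
  (forall i, continuous (f i)) ->
  exists2 h : set_type E -> set_type prod_dom, continuous h &
    forall i t, prod_rep (h t) i = f i t.
Proof.
move=> cf; have gP i : {g : set_type E -> set_type (D i) |
    continuous g /\ f i = @delta i \o g}.
  by apply: cid; have [_ _ ad] := adm_delta i; have [g ? ?] := ad _ _ (cf i); exists g.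
have [h ch hP] := @prod_comp_lift _ (fun i => sval (gP i)) (fun i => (svalP (gP i)).1).
exists h => // i t; rewrite /prod_rep hP.
by have := svalP (gP i) => -[_ /(congr1 (fun F => F t))].
Qed.

Lemma prod_rep_admissible : admissible_representation (prod_rep : _ -> prod_space).
Proof.
split; [exact: final_delta_continuous|exact: prod_rep_surjective|].
move=> E phi cphi.
have [h ch hP] := @prod_rep_lift E (fun i => prod_proj i \o phi)
  (fun i => comp_continuous cphi (@prod_proj_continuous i)).
exists h => //; apply/funext => t; apply/functional_extensionality_dep => i.
by rewrite /= hP.
Qed.

Lemma prod_space_qcb0 : qcb0 prod_space.
Proof.
apply: qcb0_final; first exact: prod_rep_surjective.
apply: kolmogorov_separated => f g fg.
have [i fgi] : exists i, prod_proj i f <> prod_proj i g.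
  apply: contrapT => /forallNP H; apply: fg.
  by apply/functional_extensionality_dep => i; exact: contrapT.
exists (X i), (prod_proj i); split=> //; first by case: (qcbX i).
exact: prod_proj_continuous.
Qed.

Lemma prod_space_product : qcb0_product prod_proj.
Proof.
split; [exact: prod_space_qcb0|exact: prod_proj_continuous|].
move=> Z f qZ cf; exists (fun z i => f i z); split.
  split=> //; have [E [phi qphi]] := qcb0_quotient_representation qZ.
  apply: (quotient_continuous_comp qphi).
  have [h ch hP] := @prod_rep_lift E (fun i => f i \o phi)
    (fun i => comp_continuous (let: And3 c _ _ := qphi in c) (cf i)).
  rewrite (_ : _ \o _ = prod_rep \o h); last first.
    by apply/funext => t; apply/functional_extensionality_dep => i; rewrite /= hP.
  exact: comp_continuous ch (@final_delta_continuous _ _ _).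
move=> h [_ hP]; apply/funext => z; apply/functional_extensionality_dep => i.
by rewrite -(hP i).
Qed.

Lemma prod_rep_EQ : EQ (prod_rep : _ -> prod_space) =
  [set z | forall i, EQ (delta (i := i)) (column (c i) z.1, column (c i) z.2)].
Proof.
apply/seteqP; split=> [[x y] [p [q [/= <- <- pq]]] i|[x y] /= H].
  exists (prod_comp i p), (prod_comp i q); split=> //.
  exact: (congr1 (fun f : forall i, X i => f i) pq).
have Dx : prod_dom x by move=> i; have [p [q [/= <- _ _]]] := H i; exact: set_valP.
have Dy : prod_dom y by move=> i; have [p [q [_ /= <- _]]] := H i; exact: set_valP.
have [p px] := set_type_exists Dx; have [q qy] := set_type_exists Dy.
exists p, q; split=> //; apply/functional_extensionality_dep => i.
have [p' [q' [px' qy' pq]]] := H i.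
rewrite /prod_rep (_ : prod_comp i p = p'); last first.
  by apply: set_type_inj; rewrite px' -px.
by rewrite pq; congr delta; apply: set_type_inj; rewrite qy' -qy.
Qed.

End Product.

Lemma qcb0_product_unique (I : Type) (X : I -> topologicalType)
    (P P' : topologicalType) (pr : forall i, P -> X i) (pr' : forall i, P' -> X i) :
  qcb0_product pr -> qcb0_product pr' ->
  exists (u : P -> P') (v : P' -> P),
    homeomorphic u v /\ forall i, pr' i \o u = pr i.
Proof.
move=> [qP cpr uP] [qP' cpr' uP'].
have [u [[cu uE] _]] := uP' _ pr qP cpr.
have [v [[cv vE] _]] := uP _ pr' qP' cpr'.
exists u, v; split=> //; split=> //.
  have [w [_ wP]] := uP _ pr qP cpr.
  have E1 : w = v \o u.
    apply: wP; split; first exact: comp_continuous cu cv.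
    by move=> i; rewrite compA vE.
  have E2 : w = id by apply: wP; split=> //; exact: id_continuous.
  by move=> x; have := congr1 (fun f => f x) E1; rewrite E2.
have [w [_ wP]] := uP' _ pr' qP' cpr'.
have E1 : w = u \o v.
  apply: wP; split; first exact: comp_continuous cv cu.
  by move=> i; rewrite compA uE.
have E2 : w = id by apply: wP; split=> //; exact: id_continuous.
by move=> x; have := congr1 (fun f => f x) E1; rewrite E2.
Qed.

Section BinaryProduct.
Context (X1 X2 : topologicalType) (D1 D2 : set baire_space)
  (delta1 : set_type D1 -> X1) (delta2 : set_type D2 -> X2).
Hypothesis qcbX1 : qcb0 X1.
Hypothesis qcbX2 : qcb0 X2.
Hypothesis adm1 : admissible_representation delta1.
Hypothesis adm2 : admissible_representation delta2.

(** The indexed product over [bool]. The quotient representation of [P], tracked by [g1] and [g2],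
    allows continuity on [P] to be checked on names. *)
Lemma qcb0_product2_exists : exists (P : topologicalType)
    (p1 : P -> X1) (p2 : P -> X2) (D : set baire_space)
    (delta : set_type D -> P) (g1 : set_type D -> set_type D1)
    (g2 : set_type D -> set_type D2),
  [/\ qcb0_product2 p1 p2, quotient_representation delta,
    continuous g1, continuous g2 &
    p1 \o delta = delta1 \o g1 /\ p2 \o delta = delta2 \o g2].
Proof.
pose X b : topologicalType := if b then X1 else X2.
pose D b := if b then D1 else D2.
pose de b : set_type (D b) -> X b :=
  match b with true => delta1 | false => delta2 end.
pose c (b : bool) : nat := b.
have qX b : qcb0 (X b) by case: b.
have ad b : admissible_representation (@de b) by case: b.
have ci b b' : c b = c b' -> b = b' by case: b b' => -[].
have [qP cpr uP] := prod_space_product qX ad ci.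
exists (prod_space de c), (@prod_proj _ _ _ de c true), (@prod_proj _ _ _ de c false),
  (prod_dom D c), (prod_rep de (c := c)), (@prod_comp _ D c true), (@prod_comp _ D c false).
split=> //.
- split=> //; [exact: (cpr true)|exact: (cpr false)|].
  move=> Z f1 f2 qZ cf1 cf2.
  have [|h [[ch hP] hU]] := uP Z (fun b => match b with true => f1 | false => f2 end) qZ.
    by case.
  exists h; split; first by split=> //; [exact: (hP true)|exact: (hP false)].
  by move=> h' [ch' h1 h2]; apply: hU; split=> // -[].
- apply: admissible_quotient => //; exact: prod_rep_admissible ad ci.
- exact: (@prod_comp_continuous _ D c true).
- exact: (@prod_comp_continuous _ D c false).
Qed.

End BinaryProduct.

(** * Exponentials with base nat in QCB0 *)

(* Kleene's associates: [p] evaluates to [v] at [y] if the first nonzero value of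
   [p] on the (codes of the) prefixes of [y] is [v + 1]. *)
Definition evaluates (p y : baire_space) (v : nat) : Prop :=
  exists n, p (pickle (mkseq y n)) = v.+1 /\
    forall m, m < n -> p (pickle (mkseq y m)) = 0.

Lemma evaluates_fun p y v w : evaluates p y v -> evaluates p y w -> v = w.
Proof.
move=> [n [pn Hn]] [m [pm Hm]]; case: (ltngtP n m) => [/Hm|/Hn|nm].
- by rewrite pn.
- by rewrite pm.
- by move: pn; rewrite nm pm => -[].
Qed.

Lemma evaluates_agree p y v : evaluates p y v ->
  exists N, forall p' y', agree N p p' -> agree N y y' -> evaluates p' y' v.
Proof.
move=> [n [pn Hn]].
(* [M] bounds the positions of [p] that are read and [n] the length of the prefix of [y]; their sum
   gives one modulus for both. *)
pose M := \max_(m < n.+1) pickle (mkseq y m).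
have HM m : m <= n -> pickle (mkseq y m) < (n + M).+1.
  move=> mn; rewrite ltnS (leq_trans _ (leq_addl _ _)) //.
  exact: (leq_bigmax (Ordinal (mn : m < n.+1))).
exists (n + M).+1 => p' y' pp' yy'.
have E m : m <= n -> mkseq y' m = mkseq y m.
  move=> mn; apply: agree_mkseq => i im; apply: yy'.
  by rewrite ltnS (leq_trans (ltnW im))// (leq_trans mn)// leq_addr.
exists n; split; first by rewrite E// pp'// HM.
by move=> m mn; rewrite E ?(ltnW mn)// pp' ?HM ?(ltnW mn)// Hn.
Qed.

Section Exponential.
Context (Y : topologicalType) (D : set baire_space) (delta : set_type D -> Y).
Hypothesis qdelta : quotient_representation delta.

Let cdelta : continuous delta. Proof. by case: qdelta. Qed.
Let sdelta : forall y, exists p, delta p = y. Proof. by case: qdelta. Qed.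

(** The function [h] lives on [Y], so the value may not depend on the name of a point. Its
    continuity is not demanded: it follows because [delta] is a quotient map. *)
Definition exp_dom : set baire_space :=
  [set p | exists h : Y -> nat, forall y : set_type D,
    evaluates p (set_val y) (h (delta y))].

Lemma evaluates_continuous (p : baire_space) (h : Y -> nat) :
  (forall y : set_type D, evaluates p (set_val y) (h (delta y))) -> continuous h.
Proof.
move=> Hp; apply: (quotient_continuous_comp qdelta); apply/nat_continuous => y.
have [N HN] := evaluates_agree (Hp y).
apply/sub_nbhs; exists N => y' yy'; apply: evaluates_fun (Hp y') _.
exact: HN.
Qed.

Definition cfun : Type := {h : Y -> nat | continuous h}.

Definition exp_rep (p : set_type exp_dom) : cfun :=
  exist _ _ (evaluates_continuous (svalP (cid (set_valP p)))).

Lemma cfun_inj (f g : cfun) : (forall y, sval f y = sval g y) -> f = g.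
Proof. by case: f g => f cf [g cg] /= fg; exact/eq_exist/funext. Qed.

Lemma exp_repP (p : set_type exp_dom) y :
  evaluates (set_val p) (set_val y) (sval (exp_rep p) (delta y)).
Proof. by rewrite /=; case: cid. Qed.

Lemma exp_rep_eq (p : set_type exp_dom) (f : cfun) :
  (forall y, evaluates (set_val p) (set_val y) (sval f (delta y))) -> exp_rep p = f.
Proof.
move=> Hf; apply: cfun_inj => x; have [y <-] := sdelta x.
exact: evaluates_fun (exp_repP p y) (Hf y).
Qed.

Definition exp_space : topologicalType := final_space exp_rep.

Definition exp_app (f : exp_space) (y : Y) : nat := sval (f : cfun) y.

Lemma exp_app_continuous f : continuous (exp_app f).
Proof. exact: (svalP (f : cfun)). Qed.

(** Follows the convention of associates: 0 means no answer yet, [v.+1] means the answer [v]. *)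
Definition pick_value (Q : nat -> Prop) : nat :=
  if pselect (exists v, Q v) is left e then (sval (cid e)).+1 else 0.

(** On a prefix [s], the associate of [F m] answers [v] once [F] equals [v] at all parameters
    sharing the first [size s] values of [m] and all arguments whose names start with [s]. Joint
    continuity ensures that some prefix is answered. *)
Lemma exp_curry (M : set baire_space) (F : set_type M -> Y -> nat) :
  continuous (fun z : set_type M * set_type D => F z.1 (delta z.2)) ->
  exists2 g : set_type M -> set_type exp_dom, continuous g &
    forall m y, exp_app (exp_rep (g m)) y = F m y.
Proof.
move=> cF.
pose s k : seq nat := odflt [::] (unpickle k).
have sK n (y : set_type D) :
    s (pickle (mkseq (set_val y) n)) = mkseq (set_val y) n.
  by rewrite /s pickleK.
pose P (m : set_type M) (k v : nat) : Prop :=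
  forall m' (y : set_type D), agree (size (s k)) (set_val m) (set_val m') ->
    mkseq (set_val y) (size (s k)) = s k -> F m' (delta y) = v.
pose g m : baire_space := fun k => pick_value (P m k).
have gF m y : evaluates (g m) (set_val y) (F m (delta y)).
  (* The pair of [m] and [y] is itself among those tested, so the only possible answer is the right
     one. *)
  have gE n : g m (pickle (mkseq (set_val y) n)) = (F m (delta y)).+1 \/
      g m (pickle (mkseq (set_val y) n)) = 0.
    rewrite /g /pick_value; case: pselect => [e|]; last by right.
    left; case: cid => v /= /(_ m y); rewrite sK size_mkseq => -> //.
  have [n gn] : exists n, g m (pickle (mkseq (set_val y) n)) != 0.
    have := (nat_continuous _).1 cF (m, y) => -[[A B] /= [/sub_nbhs[i Ai] /sub_nbhs[j Bj]] AB].
    exists (maxn i j); rewrite /g /pick_value; case: pselect => // nE; case: nE.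
    exists (F m (delta y)) => m' y'; rewrite sK size_mkseq => mm' /mkseq_agree yy'.
    apply: (AB (m', y')); split => /=; [apply: Ai|apply: Bj] => l ll.
      by apply: mm'; rewrite leq_max ll.
    by apply: yy'; rewrite leq_max ll orbT.
  exists (ex_minn (ex_intro (fun n => g m (pickle (mkseq (set_val y) n)) != 0) n gn)).
  case: ex_minnP => k gk kmin; split; first by case: (gE k) gk => ->.
  move=> i ik; apply/eqP; apply: contraTT ik => /kmin.
  by rewrite -leqNgt.
have gD m : exp_dom (g m) by exists (F m); exact: gF.
exists (fun m => exist _ (g m) (mem_set (gD m))).
  (* The test at [k] reads only the first [size (s k)] values of the parameter; equal tests are
     equal predicates, so they receive the same chosen value. *)
  apply: sub_continuous; apply/baire_continuous => k; apply/nat_continuous => m.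
  apply/sub_nbhs; exists (size (s k)) => m' mm'.
  rewrite /g /=; congr pick_value; apply/funext => v; apply/propext.
  split=> H m'' y mm'' ys; apply: H => // i il.
    by rewrite mm'' ?mm'.
  by rewrite mm'' ?mm'.
move=> m y; have [z <-] := sdelta y.
apply: evaluates_fun (gF m z).
exact: (exp_repP (exist _ (g m) (mem_set (gD m))) z).
Qed.

Lemma exp_curry_continuous (M : set baire_space) (F : set_type M -> exp_space) :
  continuous (fun z : set_type M * set_type D => exp_app (F z.1) (delta z.2)) ->
  exists2 g : set_type M -> set_type exp_dom, continuous g & F = exp_rep \o g.
Proof.
move=> /(@exp_curry M (fun m => exp_app (F m)))[g cg gF]; exists g => //.
by apply/funext => m; apply: cfun_inj => y; rewrite -[LHS]/(exp_app (F m) y) -gF.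
Qed.

Lemma exp_rep_surjective (f : exp_space) : exists p, exp_rep p = f.
Proof.
have [|g _ gf] := @exp_curry_continuous setT (fun=> f).
  apply: (comp_continuous (g := fun y => exp_app f (delta y)) (@snd_continuous _ _)).
  exact: comp_continuous cdelta (@exp_app_continuous f).
have [p _] := @set_type_exists setT (fun=> 0) I.
by exists (g p); have /= <- := congr1 (fun F : _ -> exp_space => F p) gf.
Qed.

(* Sets of functions constant on a convergent sequence are open, so a
   continuous family of functions converges continuously. *)
Lemma exp_open_sequence (y : set_type D) (s : nat -> set_type D) (N v : nat) :
  (forall k, agree k (set_val y) (set_val (s k))) ->
  open [set f : exp_space | exp_app f (delta y) = v /\
    forall k, N <= k -> exp_app f (delta (s k)) = v].
Proof.
move=> sy; rewrite final_openE openE => p [/= py ps]; apply/sub_nbhs.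
have appE (q : set_type exp_dom) (z : set_type D) w :
    evaluates (set_val q) (set_val z) w -> exp_app (exp_rep q) (delta z) = w.
  exact: evaluates_fun (exp_repP q z).
have ev z : exp_app (exp_rep p) (delta z) = v -> evaluates (set_val p) (set_val z) v.
  by move=> <-; exact: exp_repP.
(* For [k] at least [L], the name [s k] shares with [y] the prefix that is read, so the modulus at
   [y] serves; the finitely many smaller [k] are handled by [L']. *)
have [L HL] := evaluates_agree (ev _ py).
have [L' HL'] : exists L', forall k, k < L -> N <= k -> forall q : set_type exp_dom,
    agree L' (set_val p) (set_val q) -> exp_app (exp_rep q) (delta (s k)) = v.
  elim: (L) => [|K [L1 H1]]; first by exists 0.
  have [NK|KN] := leqP N K; last first.
    exists L1 => k; rewrite ltnS leq_eqVlt => /orP[/eqP->|]; last exact: H1.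
    by rewrite leqNgt KN.
  have [L2 H2] := evaluates_agree (ev _ (ps K NK)).
  exists (maxn L1 L2) => k; rewrite ltnS leq_eqVlt => /orP[/eqP->|kK] Nk q pq.
    by apply: appE; apply: H2 => // i iL; apply: pq; rewrite leq_max iL orbT.
  by apply: H1 => // i iL; apply: pq; rewrite leq_max iL.
exists (maxn L L') => q pq.
have pqL : agree L (set_val p) (set_val q) by move=> i iL; apply: pq; rewrite leq_max iL.
split=> [|k Nk]; first by apply: appE; exact: HL.
have [kL|Lk] := ltnP k L.
  by apply: HL' => // i iL; apply: pq; rewrite leq_max iL orbT.
by apply: appE; apply: HL => // i iL; apply: sy; exact: leq_trans iL Lk.
Qed.

(** If continuity fails at [(m, y)], pairs converging to it take values other than [v]. By
    continuity of [F m], this function is in the open set [U] of functions with value [v] at [y] and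
    along the tail of the sequence of arguments; continuity of [F] brings late members of the family
    into [U], a contradiction. *)
Lemma exp_uncurry_continuous (M : set baire_space) (F : set_type M -> exp_space) :
  continuous F ->
  continuous (fun z : set_type M * set_type D => exp_app (F z.1) (delta z.2)).
Proof.
move=> cF; apply/nat_continuous => -[m y] /=; apply: contrapT => nH.
set v := exp_app (F m) (delta y) in nH.
have /choice[ms msP] k : exists ms : set_type M * set_type D,
    [/\ agree k (set_val m) (set_val ms.1), agree k (set_val y) (set_val ms.2) &
      exp_app (F ms.1) (delta ms.2) <> v].
  apply: contrapT => /forallNP H; apply: nH.
  exists ([set m' | agree k (set_val m) (set_val m')],
          [set y' | agree k (set_val y) (set_val y')]) => /=.
    by split; apply/sub_nbhs; exists k.
  move=> [m' y'] [/= mm' yy']; apply: contrapT => ne.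
  by apply: (H (m', y')); split.
have [N HN] : exists N, forall y' : set_type D,
    agree N (set_val y) (set_val y') -> exp_app (F m) (delta y') = v.
  have cy : continuous (fun y' : set_type D => exp_app (F m) (delta y')).
    exact: comp_continuous cdelta (@exp_app_continuous _).
  by have /sub_nbhs := (nat_continuous _).1 cy y.
pose U := [set f : exp_space | exp_app f (delta y) = v /\
    forall k, N <= k -> exp_app f (delta (ms k).2) = v].
have oU : open U.
  by apply: (@exp_open_sequence y (fun k => (ms k).2)) => k; case: (msP k).
have /cF/sub_nbhs[L HL] : nbhs (F m) U.
  apply: open_nbhs_nbhs; split=> //; split=> // k Nk; apply: HN => i iN.
  by have [_ + _] := msP k; apply; exact: leq_trans iN Nk.
have [mm yy ne] := msP (maxn N L); apply: ne.
have [_ ] : U (F (ms (maxn N L)).1).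
  by apply: HL => i iL; apply: mm; rewrite leq_max iL orbT.
by apply; exact: leq_maxl.
Qed.

Lemma exp_rep_admissible : admissible_representation (exp_rep : _ -> exp_space).
Proof.
split; [exact: final_delta_continuous|exact: exp_rep_surjective|].
by move=> M F /exp_uncurry_continuous/exp_curry_continuous.
Qed.

Lemma exp_app_continuousl y : continuous (exp_app ^~ y).
Proof.
have [z <-] := sdelta y; apply/continuousP => A _; rewrite final_openE openE => p /= pA.
have [N HN] := evaluates_agree (exp_repP p z).
apply/sub_nbhs; exists N => q pq.
suff -> : (exp_rep @^-1` (fun f : exp_space => A (exp_app f (delta z)))) q =
  A (exp_app (exp_rep p) (delta z)) by [].
congr A; apply: evaluates_fun (exp_repP q z) _; exact: HN.
Qed.

Lemma exp_space_qcb0 : qcb0 exp_space.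
Proof.
apply: qcb0_final; first exact: exp_rep_surjective.
apply: kolmogorov_separated => f g fg.
have [y fgy] : exists y, exp_app f y <> exp_app g y.
  apply: contrapT => /forallNP H; apply: fg.
  by apply: cfun_inj => y; exact: contrapT.
exists nat, (exp_app ^~ y); split=> //; first exact: kolmogorov_nat.
exact: exp_app_continuousl.
Qed.

(** One condition expresses both that the two points are associates of functions on [Y] and that
    these functions are equal. *)
Lemma exp_rep_EQ : EQ (exp_rep : _ -> exp_space) =
  [set z | forall x y, EQ delta (x, y) ->
    exists2 v, evaluates z.1 x v & evaluates z.2 y v].
Proof.
apply/seteqP; split=> [[x y] [p [q [/= <- <- pq]]] _ _ [r [s [/= <- <- rs]]]|[x y] /= H].
  exists (sval (exp_rep p) (delta r)); first exact: exp_repP.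
  by rewrite rs pq; exact: exp_repP.
have EQr r r' : delta r = delta r' -> EQ delta (set_val r, set_val r').
  by exists r, r'.
(* Comparing the conditions at [(r, r)], [(r, r')] and [(r', r')] shows that both associates keep
   the same value from one name of [z] to another. *)
have /choice[w wP] z : exists v, forall r, delta r = z ->
    evaluates x (set_val r) v /\ evaluates y (set_val r) v.
  have [r rz] := sdelta z; have [v xv yv] := H _ _ (EQr r r erefl).
  exists v => r' rz'.
  have [v1 xv1 yv1] := H _ _ (EQr r r' (etrans rz (esym rz'))).
  have [v2 xv2 yv2] := H _ _ (EQr r' r' erefl).
  by rewrite (evaluates_fun xv xv1) {1}(evaluates_fun yv1 yv2).
have Dx : exp_dom x by exists w => r; exact: (wP _ _ erefl).1.
have Dy : exp_dom y by exists w => r; exact: (wP _ _ erefl).2.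
have [p px] := set_type_exists Dx; have [q qy] := set_type_exists Dy.
exists p, q; split=> //; apply: exp_rep_eq => r.
rewrite px (evaluates_fun (exp_repP q r) (v := _) (w := w (delta r))).
  exact: (wP _ _ erefl).1.
by rewrite qy; exact: (wP _ _ erefl).2.
Qed.

End Exponential.

(** Constant maps out of [nat] play the role of points: they show that a categorical product has the
    cartesian product as its underlying set. *)
Lemma qcb0_product2_pair (X1 X2 Q : topologicalType) (q1 : Q -> X1) (q2 : Q -> X2) :
  qcb0_product2 q1 q2 -> exists pair : X1 -> X2 -> Q,
  [/\ forall x y, q1 (pair x y) = x, forall x y, q2 (pair x y) = y,
    forall w, pair (q1 w) (q2 w) = w &
    forall (M : topologicalType) (f1 : M -> X1) (f2 : M -> X2), qcb0 M ->
      continuous f1 -> continuous f2 -> continuous (fun m => pair (f1 m) (f2 m))].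
Proof.
move=> [qQ c1 c2 uQ].
have injQ w w' : q1 w = q1 w' -> q2 w = q2 w' -> w = w'.
  move=> e1 e2.
  have [h [_ hU]] := uQ nat (fun=> q1 w) (fun=> q2 w) qcb0_nat
    (@cst_continuous _ _ _) (@cst_continuous _ _ _).
  have h1 : h = fun=> w by apply: hU; split=> //; exact: cst_continuous.
  have h2 : h = fun=> w'.
    by apply: hU; split; [exact: cst_continuous|rewrite e1|rewrite e2].
  by have := congr1 (fun f => f 0) h1; rewrite h2.
have pP x y : {w | q1 w = x /\ q2 w = y}.
  apply: cid; have [h [[_ h1 h2] _]] := uQ nat (fun=> x) (fun=> y) qcb0_nat
    (@cst_continuous _ _ _) (@cst_continuous _ _ _).
  exists (h 0); split; first exact: (congr1 (fun f => f 0) h1).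
  exact: (congr1 (fun f => f 0) h2).
exists (fun x y => sval (pP x y)).
have p1 x y : q1 (sval (pP x y)) = x by case: (svalP (pP x y)).
have p2 x y : q2 (sval (pP x y)) = y by case: (svalP (pP x y)).
split=> // [w|M f1 f2 qM cf1 cf2]; first exact: injQ.
have [h [[ch h1 h2] _]] := uQ M f1 f2 qM cf1 cf2.
rewrite (_ : (fun m => _) = h)//; apply/funext => m; apply: injQ.
  by rewrite p1 -h1.
by rewrite p2 -h2.
Qed.

Lemma exp_space_exponential (Y : topologicalType) (D : set baire_space)
    (delta : set_type D -> Y) (qdelta : quotient_representation delta) :
  qcb0 Y -> admissible_representation delta ->
  qcb0_exponential nat Y (exp_space qdelta).
Proof.
move=> qY adm; split; first exact: exp_space_qcb0.
have [P [p1 [p2 [DP [dP [g1 [g2 [prodP qdP cg1 cg2 [e1 e2]]]]]]]]] :=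
  qcb0_product2_exists (exp_space_qcb0 qdelta) qY (exp_rep_admissible qdelta) adm.
pose app : exp_space qdelta -> Y -> nat := @exp_app Y D delta qdelta.
exists P, p1, p2, (fun w => app (p1 w) (p2 w)); split=> //.
  apply: (quotient_continuous_comp qdP).
  have -> : (fun w => app (p1 w) (p2 w)) \o dP =
      (fun t => app (exp_rep qdelta (g1 t)) (delta (g2 t))).
    apply/funext => t /=; have /= -> := congr1 (fun F => F t) e1.
    by have /= -> := congr1 (fun F => F t) e2.
  apply: (comp_continuous (g := fun z => app (exp_rep qdelta z.1) (delta z.2))
    (pair_continuous cg1 cg2)).
  exact/exp_uncurry_continuous/final_delta_continuous.
move=> Z Q q1 q2 f qZ prodQ cf.
have [pair [pair1 pair2 pairE cpair]] := qcb0_product2_pair prodQ.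
have cfp z : continuous (fun y => f (pair z y)).
  apply: comp_continuous cf; apply: cpair => //; first exact: cst_continuous.
  exact: id_continuous.
(* The transpose of [f]; its continuity is tested on names of points of [Z], where currying is
   available. *)
pose g z : exp_space qdelta := exist _ (fun y => f (pair z y)) (cfp z).
have cg : continuous g.
  have [E [phi qphi]] := qcb0_quotient_representation qZ.
  have [cphi _ _] := qphi; have [cdelta _ _] := qdelta.
  apply: (quotient_continuous_comp qphi).
  have [|g' cg' ->] := @exp_curry_continuous _ _ _ qdelta E (g \o phi).
    apply: (comp_continuous _ cf).
    apply: (cpair _ (fun z => phi z.1) (fun z => delta z.2)).
    - exact: qcb0_sub_prod.
    - exact: comp_continuous (@fst_continuous _ _) cphi.
    - exact: comp_continuous (@snd_continuous _ _) cdelta.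
  exact: comp_continuous cg' (@final_delta_continuous _ _ _).
exists g; split.
  split=> //; have [_ _ _ uP] := prodP; have [qQ cq1 cq2 _] := prodQ.
  have [k [[ck k1 k2] _]] := uP Q (g \o q1) q2 qQ (comp_continuous cq1 cg) cq2.
  exists k; split=> //; apply/funext => w /=.
  have /= -> := congr1 (fun F => F w) k1; have /= -> := congr1 (fun F => F w) k2.
  by rewrite /app /exp_app /= pairE.
move=> g' [_ [k [_ k1 k2 kev]]]; apply/funext => z; apply: cfun_inj => y /=.
have /= <- := congr1 (fun F => F (pair z y)) kev.
have /= -> := congr1 (fun F => F (pair z y)) k1.
by have /= -> := congr1 (fun F => F (pair z y)) k2; rewrite pair1 pair2.
Qed.

Lemma qcb0_exponential_unique (Y X E E' : topologicalType) :
  qcb0_exponential Y X E -> qcb0_exponential Y X E' ->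
  exists (u : E -> E') (v : E' -> E), homeomorphic u v.
Proof.
move=> [qE [P [p1 [p2 [ev [prodP cev uE]]]]]] [qE' [P' [p1' [p2' [ev' [prodP' cev' uE']]]]]].
have [u [[cu [k [ck k1 k2 kev]]] _]] := uE' E P p1 p2 ev qE prodP cev.
have [v [[cv [l [cl l1 l2 lev]]] _]] := uE E' P' p1' p2' ev' qE' prodP' cev'.
exists u, v; split=> //.
  have [w [_ wP]] := uE E P p1 p2 ev qE prodP cev.
  have E1 : w = v \o u.
    apply: wP; split; first exact: comp_continuous cu cv.
    exists (l \o k); split.
    - exact: comp_continuous ck cl.
    - by rewrite compA l1 -compA k1.
    - by rewrite compA l2.
    - by rewrite compA lev.
  have E2 : w = id.
    apply: wP; split; first exact: id_continuous.
    by exists id; split=> //; exact: id_continuous.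
  by move=> x; have := congr1 (fun f => f x) E1; rewrite E2.
have [w [_ wP]] := uE' E' P' p1' p2' ev' qE' prodP' cev'.
have E1 : w = u \o v.
  apply: wP; split; first exact: comp_continuous cv cu.
  exists (k \o l); split.
  - exact: comp_continuous cl ck.
  - by rewrite compA k1 -compA l1.
  - by rewrite compA k2.
  - by rewrite compA kev.
have E2 : w = id.
  apply: wP; split; first exact: id_continuous.
  by exists id; split=> //; exact: id_continuous.
by move=> x; have := congr1 (fun f => f x) E1; rewrite E2.
Qed.

(** * Sets that are images of closed subsets of a space *)

Lemma qcb0_separable (X : topologicalType) (x0 : X) : qcb0 X ->
  exists s : nat -> X, forall U : set X, open U -> U !=set0 -> exists n, U (s n).
Proof.
move=> /qcb0_quotient_representation[D [phi [cphi sphi _]]].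
have [V [clV VP]] := sub_base D.
have /choice[s sP] n : exists x, V n !=set0 -> exists2 p, V n p & phi p = x.
  have [[p Vp]|nV] := pselect (V n !=set0); last by exists x0.
  by exists (phi p) => _; exists p.
exists s => U oU [x Ux]; have [p px] := sphi x.
have [|n [Vp VU]] := VP p (phi @^-1` U).
  by apply: cphi; apply: open_nbhs_nbhs; rewrite px.
have [|q Vq qs] := sP n; first by exists p.
by exists n; rewrite -qs; exact: VU.
Qed.

Lemma nat_representation :
  exists (D : set baire_space) (delta : set_type D -> nat),
    admissible_representation delta /\ closed (EQ delta).
Proof.
exists setT, (fun p => set_val p 0); split.
  split=> [|n|E phi cphi].
  - exact: comp_continuous (@sub_val_continuous _) (@baire_eval_continuous 0).
  - have [p pn] := @set_type_exists setT (fun=> n) I.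
    by exists p; rewrite pn.
  - have gP m : exists q : set_type [set: baire_space], set_val q = fun=> phi m.
      exact: set_type_exists.
    have /choice[g gE] := gP; exists g; last by apply/funext => m; rewrite /= gE.
    apply: sub_continuous; apply/baire_continuous => n.
    by rewrite (_ : (fun t => _) = phi)//; apply/funext => t; rewrite gE.
rewrite (_ : EQ _ = [set z | z.1 0 = z.2 0]); last first.
  apply/seteqP; split=> [[x y] [p [q [/= <- <- //]]]|[x y] /= xy].
  have [p px] := @set_type_exists setT x I; have [q qy] := @set_type_exists setT y I.
  by exists p, q; rewrite px qy.
have cf : continuous (fun z : baire_space * baire_space => (z.1 0 == z.2 0 : nat)).
  apply/nat_continuous => -[x y]; exists (agree 1 x, agree 1 y).
    by split; exact: agree_nbhs.
  by move=> [x' y'] [/= xx yy]; rewrite xx// yy.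
rewrite (_ : [set z | _] =
  (fun z : baire_space * baire_space => (z.1 0 == z.2 0 : nat)) @^-1` [set 1]).
  by move/continuous_closedP: cf; apply; exact: discrete_closed.
by apply/seteqP; split=> -[x y] /=; case: eqP.
Qed.

Lemma closed_diagonal_baire : closed [set z : baire_space * baire_space | z.1 = z.2].
Proof.
rewrite -[X in closed X]setCK; apply: open_closedC; rewrite openE => -[x y] /= xy.
have [n xyn] : exists n, x n <> y n.
  by apply: contrapT => /forallNP H; apply: xy; apply/funext => n; exact: contrapT.
exists (agree n.+1 x, agree n.+1 y); first by split; exact: agree_nbhs.
move=> [x' y'] [/= xx yy] xy'; apply: xyn.
by rewrite -(xx n)// -(yy n)// xy'.
Qed.

Section ExponentialFacts.
Context (Y E : topologicalType) (D : set baire_space) (delta : set_type D -> Y).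
Hypothesis qY : qcb0 Y.
Hypothesis adm : admissible_representation delta.
Hypothesis expE : qcb0_exponential nat Y E.

(** Carries the facts about [exp_space] over to any exponential by a homeomorphism, so that points
    of [E] can be handled as continuous functions. *)
Lemma qcb0_exponential_app : exists app : E -> Y -> nat,
  [/\ forall y, continuous (app ^~ y), forall f, continuous (app f),
    forall h : Y -> nat, continuous h -> exists f, app f = h,
    forall f g, app f = app g -> f = g &
    forall (M : set baire_space) (F : set_type M -> E),
      continuous (fun z : set_type M * set_type D => app (F z.1) (delta z.2)) ->
      continuous F].
Proof.
have qd := admissible_quotient qY adm.
have [u [v [cu cv uK vK]]] := qcb0_exponential_unique expE (exp_space_exponential qd qY adm).
exists (fun f => @exp_app Y D delta qd (u f)); split.
- move=> y.
  exact: (comp_continuous (g := @exp_app Y D delta qd ^~ y) cu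
    (@exp_app_continuousl _ _ _ qd y)).
- by move=> f; exact: exp_app_continuous.
- move=> h ch; exists (v (exist _ h ch : exp_space qd)).
  by rewrite vK.
- move=> f g fg; apply: (can_inj uK); apply: cfun_inj => y.
  exact: (congr1 (fun F => F y) fg).
- move=> M F cF; have [g cg gF] := @exp_curry_continuous Y D delta qd M (u \o F) cF.
  rewrite (_ : F = fun t => v (u (F t))); last by apply/funext => t; rewrite uK.
  apply: comp_continuous cv.
  have -> : (fun t => u (F t)) = exp_rep qd \o g by exact: gF.
  exact: (comp_continuous cg (@final_delta_continuous _ _ (exp_rep qd))).
Qed.

Lemma qcb0_exponential_representation :
  exists (D' : set baire_space) (delta' : set_type D' -> E),
    admissible_representation delta' /\
    EQ delta' = [set z | forall x y, EQ delta (x, y) ->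
      exists2 v, evaluates z.1 x v & evaluates z.2 y v].
Proof.
have qd := admissible_quotient qY adm.
have [u [v hom]] := qcb0_exponential_unique (exp_space_exponential qd qY adm) expE.
have [ad EQE] := homeomorphic_representation hom (exp_rep_admissible qd).
exists (exp_dom delta), (u \o exp_rep qd); split=> //.
by rewrite EQE exp_rep_EQ.
Qed.

End ExponentialFacts.

(** Base case of the upper bound. Describing equality through associates involves a projection,
    which level zero does not absorb; here a function is named by its sequence of values, and
    equality becomes the closed diagonal. *)
Lemma baire_exponential_representation (E : topologicalType) :
  qcb0_exponential nat nat E ->
  exists (D : set baire_space) (delta : set_type D -> E),
    admissible_representation delta /\ closed (EQ delta).
Proof.
move=> expE; have [D0 [d0 [ad0 _]]] := nat_representation.
have [app [capp _ sapp iapp curry]] := qcb0_exponential_app qcb0_nat ad0 expE.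
have cnat (h : nat -> nat) : continuous h.
  by apply/nat_continuous => n; rewrite /prop_near1 nat_nbhs.
have /choice[f fP] h : exists f, app f = h by exact: sapp.
exists setT, (fun p => f (set_val p)); split.
  split=> [|e|M phi cphi].
  - apply: curry; have [cd0 _ _] := ad0.
    apply/nat_continuous => -[p y].
    have := (nat_continuous _).1 cd0 y => yy.
    exists ([set q | agree (d0 y).+1 (set_val p) (set_val q)], [set y' | d0 y' = d0 y]).
      by split=> //; apply/sub_nbhs; exists (d0 y).+1.
    by move=> [q y'] [/= pq ->]; rewrite !fP pq.
  - have [p pE] := @set_type_exists setT (app e) I.
    by exists p; apply: iapp; rewrite fP pE.
  - have gP m : exists q : set_type [set: baire_space], set_val q = app (phi m).
      exact: set_type_exists.
    have /choice[g gE] := gP; exists g.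
      apply: sub_continuous; apply/baire_continuous => n.
      rewrite (_ : (fun t => _) = fun t => app (phi t) n).
        exact: comp_continuous cphi (capp n).
      by apply/funext => t; rewrite gE.
    by apply/funext => m; apply: iapp; rewrite /= fP gE.
rewrite (_ : EQ _ = [set z | z.1 = z.2]); first exact: closed_diagonal_baire.
apply/seteqP; split=> [[x y] [p [q [/= <- <- pq]]]|[x y] /= <-].
  by rewrite -(fP (set_val p)) pq fP.
by have [p px] := @set_type_exists setT x I; exists p, p.
Qed.

(* The zero sets [{x | c x = 0}] serve as the closed subsets of [X]: unlike
   for an arbitrary closed set, failure to belong to one is witnessed by a
   number depending continuously on the point. *)
Definition closed_image (X : topologicalType) (A : set baire_space) : Prop :=
  exists pi c : X -> baire_space,
    [/\ continuous pi, continuous c & A = pi @` [set x | c x = fun=> 0]].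

(** Bounds the complexity of [A] by that of [EQ delta], whose diagonal is the domain of [delta]. *)
Lemma closed_image_representation (X : topologicalType) (A : set baire_space)
    (D : set baire_space) (delta : set_type D -> X) :
  continuous delta -> (forall x, exists p, delta p = x) -> closed_image X A ->
  exists2 H : set (baire_space * baire_space)%type, closed H &
    A = fst @` ([set z | EQ delta (z.2, z.2)] `&` H).
Proof.
move=> cd sd [pi [c [cpi cc ->]]].
pose G : set (baire_space * baire_space)%type := [set z | exists p : set_type D,
  [/\ set_val p = z.2, c (delta p) = (fun=> 0) & pi (delta p) = z.1]].
(* Taking the closure adds nothing over the domain: if [y] names a point, continuity of [c] and [pi]
   along [delta] at [y] carries both equations from nearby members of [G] to [y]. *)
exists (closure G); first exact: closed_closure.
apply/seteqP; split=> [_ [x /= cx <-]|_ [[x y] /= [[p [_ [/= py _ _]]] HG] <-]].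
  have [p px] := sd x; exists (pi x, set_val p) => //; split.
    by exists p, p.
  by apply: subset_closure; exists p; rewrite px.
have near (g : X -> baire_space) n : continuous g ->
    exists N, forall q : set_type D, agree N y (set_val q) ->
      g (delta q) n = g (delta p) n.
  move=> cg; have cgd := comp_continuous cd cg.
  have /sub_nbhs[N HN] := continuous_agree n.+1 p cgd.
  by exists N => q yq; apply: HN; rewrite ?py.
exists (delta p); apply/funext => n; apply: contrapT => ne.
  have [N HN] := near c n cc.
  have [|[x' y'] [[q [/= qy cq _]] [_ yy']]] := HG (setT `*` agree N y).
    by exists (setT, agree N y) => //; split; [exact: filterT|exact: agree_nbhs].
  by apply: ne; rewrite -(HN q) ?qy// cq.
have [N HN] := near pi n cpi.
have [|[x' y'] [[q [/= qy _ piq]] [/= xx' yy']]] := HG (agree n.+1 x `*` agree N y).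
  by exists (agree n.+1 x, agree N y) => //; split; exact: agree_nbhs.
by apply: ne; rewrite -(HN q) ?qy// piq xx'.
Qed.

Definition differs (p q c : baire_space) (n : nat) : bool :=
  (q n != p n) || (c n != 0).

(** Asking for the first place makes the witness unique, and hence a continuous function of the
    data. *)
Definition first_differs (p q c : baire_space) (n : nat) : bool :=
  differs p q c n && all (fun m => ~~ differs p q c m) (iota 0 n).

Lemma first_differs_agree p q c p' q' c' n :
  agree n.+1 p p' -> agree n.+1 q q' -> agree n.+1 c c' ->
  first_differs p' q' c' n = first_differs p q c n.
Proof.
move=> pp qq cc.
have E m : m < n.+1 -> differs p' q' c' m = differs p q c m.
  by move=> mn; rewrite /differs pp// qq// cc.
rewrite /first_differs E//; congr (_ && _); apply: eq_in_all => m.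
by rewrite mem_iota add0n => /andP[_ mn]; rewrite E// ltnW.
Qed.

Lemma first_differs_inj p q c n m :
  first_differs p q c n -> first_differs p q c m -> n = m.
Proof.
move=> /andP[dn /allP Hn] /andP[dm /allP Hm]; case: (ltngtP n m) => // [nm|mn].
  by have := Hm n; rewrite mem_iota add0n nm dn => /(_ isT).
by have := Hn m; rewrite mem_iota add0n mn dm => /(_ isT).
Qed.

Lemma first_differs_exists p q c : ~ (q = p /\ c = fun=> 0) ->
  exists n, first_differs p q c n.
Proof.
move=> ne; have [n dn] : exists n, differs p q c n.
  apply: contrapT => /forallNP H; apply: ne.
  split; apply/funext => n; apply/eqP; apply: contrapT => /negP ne;
    by apply: (H n); rewrite /differs ne ?orbT.
exists (ex_minn (ex_intro _ n dn)); case: ex_minnP => k dk kmin.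
rewrite /first_differs dk /=; apply/allP => m; rewrite mem_iota add0n => /andP[_ mk].
by apply/negP => /kmin; rewrite leqNgt mk.
Qed.

Lemma first_differs_continuous (T : topologicalType) (p q c : T -> baire_space)
    (n : T -> nat) :
  continuous p -> continuous q -> continuous c -> continuous n ->
  continuous (fun t => first_differs (p t) (q t) (c t) (n t) : nat).
Proof.
move=> cp cq cc cn; apply/nat_continuous => t.
near=> t'; congr nat_of_bool.
have -> : n t' = n t by near: t'; exact: (nat_continuous _).1.
by apply: first_differs_agree; near: t'; exact: continuous_agree.
Unshelve. all: by end_near. Qed.

(* A point [f] of [nat^Y] codes [p] by its values on a discrete family [z n], and
   at every [y] the first place where [y] fails to witness that [p] is in the
   projection of [A]; that [f] is such a code need only be checked on a countable
   dense set. *)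
Lemma closed_image_exponential (Y E : topologicalType) (D : set baire_space)
    (delta : set_type D -> Y) (r : Y -> nat) (z : nat -> Y) (A : set baire_space) :
  qcb0 Y -> admissible_representation delta -> qcb0_exponential nat Y E ->
  continuous r -> cancel z r -> closed_image Y A ->
  closed_image E (~` (column 0 @` A)).
Proof.
move=> qY adm expE cr zK [pi [c [cpi cc ->]]].
have [app [capp cappr sapp _ _]] := qcb0_exponential_app qY adm expE.
have [s sdense] := qcb0_separable (z 0) qY.
have cnat (h : nat -> nat) : continuous h.
  by apply/nat_continuous => n; rewrite /prop_near1 nat_nbhs.
(* The value of [f] at [z n] is to be a pair with first component [p n]; second components are the
   places of failure. *)
pose pi' f : baire_space := fun n => (nunpair (app f (z n))).1.
pose q y := column 0 (pi y).
have cq : continuous q by exact: comp_continuous cpi (@column_continuous 0).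
pose c' f : baire_space := fun k =>
  1 - first_differs (pi' f) (q (s k)) (c (s k)) (nunpair (app f (s k))).2.
have cpi' : continuous pi'.
  apply/baire_continuous => n.
  exact: comp_continuous (capp (z n)) (cnat (fun k => (nunpair k).1)).
exists pi', c'; split=> //.
  apply/baire_continuous => k; apply: (comp_continuous _ (cnat (fun i => 1 - i))).
  apply: (@first_differs_continuous E pi' (fun=> q (s k)) (fun=> c (s k))
    (fun f => (nunpair (app f (s k))).2)) => //; try exact: cst_continuous.
  exact: comp_continuous (capp (s k)) (cnat (fun k => (nunpair k).2)).
have first0 b : (1 - nat_of_bool b = 0) <-> b by case: b.
apply/seteqP; split=> [p /= Hp|_ [f /= cf <-] [_ [y cy <-] qy]].
  have /choice[F FP] y : exists n, first_differs p (q y) (c y) n.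
    by apply: first_differs_exists => -[qp cy]; apply: Hp; exists (pi y) => //; exists y.
  (* Near [y], the number [F y] remains a first place of failure, and uniqueness makes it the value
     of [F] there. *)
  have cF : continuous F.
    apply/nat_continuous => y.
    have := (nat_continuous _).1 (@first_differs_continuous Y (fun=> p) q c (fun=> F y)
      (@cst_continuous _ _ _) cq cc (@cst_continuous _ _ _)) y.
    apply: filterS => y' /=; rewrite FP => e.
    by apply: first_differs_inj (FP y') _; move: e; case: first_differs.
  (* Since [r (z n) = n], the first component at [z n] is indeed [p n]. *)
  have [f fE] : exists f, app f = fun y => npair (p (r y)) (F y).
    apply: sapp; apply/nat_continuous => y.
    have cpr : continuous (fun y => p (r y)) := comp_continuous cr (cnat p).
    have := (nat_continuous _).1 cF y; apply: filterS2 ((nat_continuous _).1 cpr y).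
    by move=> y' /= -> ->.
  have pf : pi' f = p by apply/funext => n; rewrite /pi' fE npairK /= zK.
  by exists f => //; apply/funext => k; apply/first0; rewrite pf fE npairK.
(* [bad] is continuous and vanishes on the dense sequence [s], hence everywhere; at a [y] witnessing
   that the point is in the projection, there is no place of failure. *)
pose bad y := 1 - first_differs (pi' f) (q y) (c y) (nunpair (app f y)).2.
have cbad : continuous bad.
  apply: (comp_continuous _ (cnat (fun i => 1 - i))).
  apply: (@first_differs_continuous Y (fun=> pi' f) q c
    (fun y => (nunpair (app f y)).2)) => //; try exact: cst_continuous.
  exact: comp_continuous (cappr f) (cnat (fun k => (nunpair k).2)).
have : bad y = 0.
  apply: contrapT => nb; have [||k] := sdense (bad @^-1` [set~ 0]).
  - by move/continuousP: cbad; apply; exact: discrete_open.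
  - by exists y.
  - by apply; exact: (congr1 (fun h : baire_space => h k) cf).
move=> /first0/andP[+ _]; rewrite /differs.
by rewrite [q y]qy cy !eqxx.
Qed.

(** * The spaces N<a> *)

(** Base case of the lower bound. A point of [E] codes [x] together with, for each [n], the index of
    a basic neighbourhood of [x] missing [F n]; that such an index is correct is a clopen
    condition. *)
Lemma closed_image_Gdelta (E : topologicalType) (A : set baire_space) :
  qcb0_exponential nat nat E -> Fsigma (~` A) -> closed_image E A.
Proof.
move=> expE [F clF AF]; have [D0 [d0 [ad0 _]]] := nat_representation.
have [app [capp _ sapp _ _]] := qcb0_exponential_app qcb0_nat ad0 expE.
have csig : continuous (app : E -> baire_space) by exact/baire_continuous.
have [V [clV VP]] := baire_base.
pose W n m : set baire_space := [set x | V m x /\ V m `<=` ~` F n].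
have clW n m : clopen (W n m).
  have [VF|nVF] := pselect (V m `<=` ~` F n).
    by rewrite (_ : W n m = V m)//; apply/seteqP; split=> [x []|x].
  rewrite (_ : W n m = set0); first by split; [exact: open0|exact: closed0].
  by apply/seteqP; split=> [x []|x].
pose chi n m (x : baire_space) : nat := if pselect (W n m x) then 0 else 1.
have cchi n m : continuous (chi n m).
  apply/nat_continuous => x; rewrite /chi; case: pselect => Wx.
    have : nbhs x (W n m) by apply: open_nbhs_nbhs; split=> //; exact: (clW n m).1.
    by apply: filterS => y Wy; case: pselect.
  have : nbhs x (~` W n m).
    by apply: open_nbhs_nbhs; split=> //; apply: closed_openC; exact: (clW n m).2.
  by apply: filterS => y Wy; case: pselect.
exists (fun e => column 0 (app e)), (fun e n => chi n (column 1 (app e) n) (column 0 (app e))).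
have c0 : continuous (fun e => column 0 (app e)).
  exact: comp_continuous csig (@column_continuous 0).
have c1 : continuous (fun e => column 1 (app e)).
  exact: comp_continuous csig (@column_continuous 1).
split=> //.
  apply/baire_continuous => n; apply/nat_continuous => e.
  have c1n := (baire_continuous _).1 c1 n.
  have cc := comp_continuous c0 (@cchi n (column 1 (app e) n)).
  apply: filterS2 ((nat_continuous _).1 c1n e) ((nat_continuous _).1 cc e).
  by move=> e' ->.
have AE x : A x <-> forall n, ~ F n x.
  rewrite -[A]setCK AF setC_bigcup; split=> [H n|H n _]; [exact: H n I|exact: H].
have chi0 n m x : chi n m x = 0 <-> W n m x by rewrite /chi; case: pselect.
apply/seteqP; split=> [x /AE Ax|_ [e /= ce <-]].
  have /choice[y Wy] n : exists m, W n m x.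
    have [|m [Vx VF]] := VP x (~` F n); last by exists m.
    by apply: open_nbhs_nbhs; split; [exact: closed_openC|exact: Ax].
  have [|e eE] := sapp (pairB x y).
    by apply/nat_continuous => n; rewrite /prop_near1 nat_nbhs.
  exists e; rewrite /= eE; last exact: column0_pairB.
  by apply/funext => n; apply/chi0; rewrite column0_pairB column1_pairB.
apply/AE => n Fn; have /chi0[Vx VF] := congr1 (fun h : baire_space => h n) ce.
exact: VF Vx Fn.
Qed.

Section Spaces.
Context {d : Order.disp_t} {W : orderType d}.
Hypothesis wfW : well_founded (fun x y : W => (x < y)%O).
Implicit Types (a b c l : W) (X Y E : topologicalType).

Lemma uncurry_columns_continuous (T : topologicalType) :
  continuous (fun z : T * baire_space => (z.1, (column 0 z.2, column 1 z.2))).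
Proof.
have cc m : continuous (fun z : T * baire_space => column m z.2).
  exact: comp_continuous (@snd_continuous _ _) (@column_continuous m).
apply: pair_continuous; first exact: fst_continuous.
by apply: pair_continuous.
Qed.

Lemma Pi1_lt_closed l (T : topologicalType) (A : set T) :
  countable_clopen_base T -> ord_limit l -> closed A -> Pi1_lt l A.
Proof.
move=> bT ll cA; have [z0 _ zP] := @ord_min _ _ wfW (fun=> True) l I.
have z0z : ord_zero z0 by move=> c; exact: zP.
exists z0; first by apply: ord_zero_lt z0z ll.1.
by apply: hyp_Sigma_zero => //; exact: (closed_delta2 bT cA).2.
Qed.

Lemma delta_Pi1_lt_le l b (T : topologicalType) (A : set T) :
  (b <= l)%O -> delta_class (Pi1_lt b) A -> delta_class (Pi1_lt l) A.
Proof.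
move=> bl [B HB ->]; exists B => // n; have [a ab PB] := HB n.
by exists a => //; exact: lt_le_trans bl.
Qed.

Lemma Pi1_lt_delta l (T : topologicalType) (A : set T) :
  Pi1_lt l A -> delta_class (Pi1_lt l) A.
Proof. by move=> PA; exists (fun=> A) => //; rewrite bigcap_const. Qed.

Lemma delta_Pi1_lt_preimage l (S T : topologicalType) (f : S -> T) (A : set T) :
  continuous f -> delta_class (Pi1_lt l) A -> delta_class (Pi1_lt l) (f @^-1` A).
Proof.
move=> cf [B HB ->]; exists (fun n => f @^-1` B n); last by rewrite preimage_bigcap.
move=> n; have [a al PB] := HB n; exists a => //.
exact: hyp_Sigma_preimage PB _ _ cf.
Qed.

Lemma delta_Pi1_lt_bigcap l (T : topologicalType) (A : nat -> set T) :
  (forall n, delta_class (Pi1_lt l) (A n)) -> delta_class (Pi1_lt l) (\bigcap_n A n).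
Proof.
move=> HA; have /choice[B HB] n : exists B : nat -> set T,
    (forall k, Pi1_lt l (B k)) /\ A n = \bigcap_k B k.
  by have [B ? ?] := HA n; exists B.
exists (fun k => B (nunpair k).1 (nunpair k).2) => [k|]; first exact: (HB _).1.
apply/seteqP; split=> [x Ax k _|x Bx n _].
  by have := Ax (nunpair k).1 I; rewrite (HB _).2; exact.
by rewrite (HB n).2 => k _; have := Bx (npair n k) I; rewrite npairK.
Qed.

Lemma countable_bigcap_delta_Pi1_lt l (I : Type) (e : nat -> I)
    (T : topologicalType) (A : I -> set T) : (forall i, exists n, e n = i) ->
  (forall i, delta_class (Pi1_lt l) (A i)) ->
  delta_class (Pi1_lt l) [set x | forall i, A i x].
Proof.
move=> eP HA; rewrite (_ : [set x | _] = \bigcap_n A (e n)).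
  exact: delta_Pi1_lt_bigcap.
apply/seteqP; split=> [x Ax n _|x Ax i]; first exact: Ax.
by have [n <-] := eP i; exact: Ax.
Qed.

Lemma evaluates_closed :
  closed [set z : baire_space * baire_space * (baire_space * baire_space) |
    ~ exists2 v, evaluates z.1.1 z.2.1 v & evaluates z.1.2 z.2.2 v].
Proof.
apply: open_closedC; rewrite openE => -[[p q] [x y]] /= [v pv qv].
have [M HM] := evaluates_agree pv; have [N HN] := evaluates_agree qv.
exists (agree M p `*` agree N q, agree M x `*` agree N y) => /=.
  split; first by exists (agree M p, agree N q) => //; split; exact: agree_nbhs.
  by exists (agree M x, agree N y) => //; split; exact: agree_nbhs.
move=> [[p' q'] [x' y']] [/= [pp qq] [xx yy]].
by exists v; [exact: HM|exact: HN].
Qed.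

Definition exp_EQ (R : set (baire_space * baire_space)%type) :
    set (baire_space * baire_space)%type :=
  [set z | forall x y, R (x, y) ->
    exists2 v, evaluates z.1 x v & evaluates z.2 y v].

(** The two equivalent names are stored in one point, so that inequality of associates is a single
    projection. *)
Definition exp_EQ_matrix (R : set (baire_space * baire_space)%type) :
    set (baire_space * baire_space * baire_space)%type :=
  (fun z => (z.1, (column 0 z.2, column 1 z.2))) @^-1`
    (snd @^-1` R `&` [set z | ~ exists2 v, evaluates z.1.1 z.2.1 v & evaluates z.1.2 z.2.2 v]).

Lemma exp_EQ_proj R : ~` exp_EQ R = fst @` exp_EQ_matrix R.
Proof.
apply/seteqP; split=> [z nz|_ [[z w] /= [Rw nv] <-] H]; last exact: nv (H _ _ Rw).
apply: contrapT => Hz; apply: nz => x y Rxy; apply: contrapT => nv; apply: Hz.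
exists (z, pairB x y) => //.
by rewrite /exp_EQ_matrix /= column0_pairB column1_pairB.
Qed.

Let baire4_base := prod_base (prod_base baire_base baire_base) (prod_base baire_base baire_base).

Lemma exp_EQ_succ a b R : ord_succ a b -> Pi1 a R -> Pi1 b (exp_EQ R).
Proof.
move=> ab PR; rewrite /Pi1 /co_class /Sigma1 exp_EQ_proj.
apply: (hyp_Sigma_succ ab (B := ~` exp_EQ_matrix R)); last by rewrite setCK.
rewrite /exp_EQ_matrix preimage_setC; apply: hyp_Sigma_preimage; last first.
  exact: uncurry_columns_continuous.
rewrite setCI; apply: hyp_SigmaU.
  by apply: delta2C; apply: closed_delta2 baire4_base _; exact: evaluates_closed.
by rewrite preimage_setC; apply: hyp_Sigma_preimage PR _ _ (@snd_continuous _ _).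
Qed.

(** Each set intersected in [R] is of class Sigma one level higher, still below [l], so the
    countable intersection fits under the projection of the limit clause. *)
Lemma exp_EQ_limit l R : ord_limit l -> delta_class (Pi1_lt l) R -> Pi1 l (exp_EQ R).
Proof.
move=> ll [B HB ->]; rewrite /Pi1 /co_class /Sigma1 exp_EQ_proj.
have /choice[b bP] n : exists b, (b < l)%O /\ hyp_Sigma b (B n).
  have [a al PB] := HB n; have [b ab bl] := ord_limit_has_succ wfW ll al.
  by exists b; split=> //; exact: Pi1_SigmaS PB.
apply: (hyp_Sigma_limit (b := b) (B := fun n => exp_EQ_matrix (B n)) ll).
- by move=> n; case: (bP n).
- move=> n; apply: hyp_Sigma_preimage; last exact: uncurry_columns_continuous.
  apply: hyp_SigmaI.
    by apply: closed_delta2 baire4_base _; exact: evaluates_closed.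
  by apply: hyp_Sigma_preimage (@snd_continuous _ _); case: (bP n).
- congr image; apply/seteqP; split=> [z [Bz nz] n _|z H]; first by split=> //; exact: Bz.
  by split=> [n _|]; [have [] := H n I|have [] := H 0 I].
Qed.

(** The upper bound in the form that the induction propagates; at zero, closedness stands in for a
    level below zero. *)
Definition admits_EQ a X := exists (D : set baire_space) (delta : set_type D -> X),
  admissible_representation delta /\
  [/\ ord_zero a -> closed (EQ delta),
      forall b, ord_succ b a -> Pi1 b (EQ delta) &
      ord_limit a -> delta_class (Pi1_lt a) (EQ delta)].

Definition represents_images a X :=
  (forall b, ord_succ b a -> forall A : set baire_space, Pi1 b A -> closed_image X A) /\
  (ord_limit a -> forall A : set baire_space, delta_class (Pi1_lt a) A -> closed_image X A).

(** The induction invariant: upper bound, lower bound, and a copy of [nat] as a retract, which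
    provides the discrete family used for coding in exponentials. *)
Definition good_space a X :=
  [/\ qcb0 X, exists (r : X -> nat) (z : nat -> X), continuous r /\ cancel z r,
    admits_EQ a X & represents_images a X].

Lemma good_space_zero a : ord_zero a -> good_space a nat.
Proof.
move=> a0; split.
- exact: qcb0_nat.
- by exists id, id; split=> //; exact: id_continuous.
- have [D [delta [ad cEQ]]] := nat_representation.
  exists D, delta; split=> //; split=> // [b|la]; first by move/(ord_zero_succ a0).
  by case: la.1.
- by split=> [b /(ord_zero_succ a0)|la]//; case: la.1.
Qed.

Lemma N_space_zeroE a X : N_space a X -> ord_zero a -> X = nat.
Proof.
move=> [//|b Y X' ba _ _ /ord_zero_succ/(_ ba)//|F X' pr la _ _ a0].
by case: la.1.
Qed.

Lemma column_pair_continuous :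
  continuous (fun w : baire_space => (column 0 w, column 1 w)).
Proof. by apply: pair_continuous; exact: column_continuous. Qed.

Lemma fst_column (S : set (baire_space * baire_space)%type) :
  fst @` S = column 0 @` ((fun w => (column 0 w, column 1 w)) @^-1` S).
Proof.
apply/seteqP; split=> [_ [[x y] Sxy <-]|_ [w Sw <-]].
  by exists (pairB x y); rewrite /= column0_pairB ?column1_pairB.
by exists (column 0 w, column 1 w).
Qed.

Lemma good_space_succ a b Y X : ord_succ b a -> N_space b Y -> good_space b Y ->
  qcb0_exponential nat Y X -> good_space a X.
Proof.
move=> ba NY [qY [r [z [cr zK]]] [D [delta [ad [_ EQs EQl]]]] [Rs Rl]] expX.
have [app [capp _ sapp _ _]] := qcb0_exponential_app qY ad expX.
have nla : ~ ord_limit a by move=> /ord_limit_succ/(_ ba).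
have na0 : ~ ord_zero a by move=> /ord_zero_succ/(_ ba).
split.
- by case: expX.
(* The constant functions form the copy of [nat], and evaluation at a point is the retraction. *)
- have /choice[k kP] n : exists f, app f = fun=> n.
    by apply: sapp; exact: cst_continuous.
  by exists (app ^~ (z 0)), k; split=> // n; rewrite kP.
- have [b0|nb0] := pselect (ord_zero b).
    move: expX; rewrite (N_space_zeroE NY b0).
    move=> /baire_exponential_representation[D' [delta' [ad' cEQ]]].
    exists D', delta'; split=> //; split=> // b' b'a.
    rewrite (ord_succ_inj b'a ba).
    apply: hyp_Sigma_zero => //; apply: (closed_delta2 _ cEQ).2.
    exact: prod_base baire_base baire_base.
  have [D' [delta' [ad' EQE]]] := qcb0_exponential_representation qY ad expX.
  exists D', delta'; split=> //; rewrite EQE; split=> // b' b'a; rewrite (ord_succ_inj b'a ba).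
  have [//|[c cb]|lb] := ord_cases b.
    exact: exp_EQ_succ cb (EQs _ cb).
  exact: exp_EQ_limit lb (EQl lb).
- split=> // b' b'a A; rewrite (ord_succ_inj b'a ba) => {b' b'a} PA.
  have [b0|[c cb]|lb] := ord_cases b.
  + move: expX; rewrite (N_space_zeroE NY b0) => expX.
    by apply: closed_image_Gdelta expX _; exact: hyp_Sigma_zeroE PA.
  (* The complement of [A] projects a Pi set of level [c], which is a closed image of [Y] by
     hypothesis; the exponential absorbs the complemented projection. *)
  + have [B HB AB] := hyp_Sigma_succE cb PA.
    rewrite -[A]setCK AB fst_column.
    apply: (closed_image_exponential qY ad expX cr zK); apply: (Rs _ cb).
    rewrite /Pi1/co_class preimage_setC setCK.
    exact: hyp_Sigma_preimage HB _ _ column_pair_continuous.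
  + have [e [B [eb HB AB]]] := hyp_Sigma_limitE lb PA.
    rewrite -[A]setCK AB fst_column.
    apply: (closed_image_exponential qY ad expX cr zK); apply: (Rl lb).
    apply: delta_Pi1_lt_preimage; first exact: column_pair_continuous.
    (* Each Sigma set is a Pi set one level higher, and the limit leaves room for that. *)
    exists B => // n; have [c ec cb] := ord_limit_has_succ wfW lb (eb n).
    by exists c => //; exact: Sigma_Pi1S ec (HB n).
Qed.

Lemma good_space_limit a (F : {b : W | (b < a)%O} -> topologicalType) X
    (pr : forall i, X -> F i) :
  ord_countable a -> ord_limit a ->
  (forall i, good_space (sval i) (F i)) -> qcb0_product pr -> good_space a X.
Proof.
move=> ca la goodF prX.
have [e [ea eP]] := ord_countable_enum ca la.1.
pose i0 : {b : W | (b < a)%O} := exist _ (e 0) (ea 0).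
have /countable_injP[f finj] := ca.
pose c (i : {b : W | (b < a)%O}) := f (sval i).
have c_inj i j : c i = c j -> i = j.
  move=> cij; apply: val_inj; apply: finj => //; rewrite inE; exact: svalP.
have qF i : qcb0 (F i) by case: (goodF i).
have rep i : {Dd : {D : set baire_space & set_type D -> F i} |
    admissible_representation (projT2 Dd) /\
    delta_class (Pi1_lt a) (EQ (projT2 Dd))}.
  apply: cid; have [_ _ [D [delta [ad [EQ0 EQs EQl]]]] _] := goodF i.
  exists (existT _ D delta); split=> //=.
  have ia : (sval i < a)%O := svalP i.
  have [i_0|[b bi]|li] := ord_cases (sval i).
  - apply: Pi1_lt_delta; apply: Pi1_lt_closed => //; last exact: EQ0.
    exact: prod_base baire_base baire_base.
  - by apply: Pi1_lt_delta; exists b; [exact: lt_trans bi.1 ia|exact: EQs].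
  - by apply: delta_Pi1_lt_le (EQl li); exact: ltW.
pose D i := projT1 (sval (rep i)).
pose delta i : set_type (D i) -> F i := projT2 (sval (rep i)).
have ad i : admissible_representation (@delta i) := (svalP (rep i)).1.
have dEQ i : delta_class (Pi1_lt a) (EQ (@delta i)) := (svalP (rep i)).2.
have [u [v [hom uE]]] := qcb0_product_unique (prod_space_product qF ad c_inj) prX.
have point (g : forall i, F i) : exists x, forall i, pr i x = g i.
  exists (u (g : prod_space delta c)) => i.
  exact: (congr1 (fun h => h (g : prod_space delta c)) (uE i)).
have cpr i : continuous (pr i) by case: prX.
split.
- by case: prX.
- have rz i : {rz : (F i -> nat) * (nat -> F i) |
      continuous rz.1 /\ cancel rz.2 rz.1}.
    by apply: cid; have [_ [r [z ?]] _ _] := goodF i; exists (r, z).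
  have /choice[z zP] n := point (fun i => (sval (rz i)).2 n).
  exists (fun x => (sval (rz i0)).1 (pr i0 x)), z; split.
    by apply: comp_continuous (cpr i0) _; case: (svalP (rz i0)).
  by move=> n; rewrite zP; case: (svalP (rz i0)).
- have [adu EQu] := homeomorphic_representation hom (prod_rep_admissible ad c_inj).
  exists (prod_dom D c), (u \o prod_rep delta (c := c)); split=> //.
  split=> [a0|b ba|_]; [by case: la.1|by case: (ord_limit_succ la ba)|].
  rewrite EQu prod_rep_EQ.
  apply: (@countable_bigcap_delta_Pi1_lt a _ (fun n => exist _ (e n) (ea n)) _
    (fun i => (fun z => (column (c i) z.1, column (c i) z.2)) @^-1` EQ (@delta i))).
    by move=> [b ba]; have [n nb] := eP b ba; exists n; exact: val_inj.
  move=> i; apply: delta_Pi1_lt_preimage => //; apply: pair_continuous.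
    exact: comp_continuous (@fst_continuous _ _) (@column_continuous _).
  exact: comp_continuous (@snd_continuous _ _) (@column_continuous _).
- split=> [b /(ord_limit_succ la)//|_ A [B HB ->]].
  have /choice[b bP] n : exists b, (b < a)%O /\ Pi1 b (B n).
    by have [b ? ?] := HB n; exists b.
  pose active (i : {b : W | (b < a)%O}) := exists b, ord_succ b (sval i).
  (* All sets of level [b'] are gathered at the index [b' + 1], whose factor represents Pi sets of
     level [b']. Many sets may share a level, so closure under countable intersection is needed. *)
  pose G (i : {b : W | (b < a)%O}) : set baire_space :=
    [set x | forall n, ord_succ (b n) (sval i) -> B n x].
  have PiG i b' : ord_succ b' (sval i) -> Pi1 b' (G i).
    move=> b'i; rewrite /Pi1/co_class/Sigma1.
    rewrite (_ : ~` G i = \bigcup_n (if b n == b' then ~` B n else set0)).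
      apply: (hyp_Sigma_bigcup wfW) => n; case: eqP => [<-|_]; first exact: (bP n).2.
      apply: (delta2_hyp_Sigma wfW); apply: clopen_delta2.
      by split; [exact: open0|exact: closed0].
    apply/seteqP; split=> [x /existsNP[n /not_implyP[bi nB]]|x [n _]].
      by exists n => //; rewrite (ord_succ_inj bi b'i) eqxx.
    by case: eqP => // bb' nB H; apply: nB; apply: H; rewrite bb'.
  have pc i : {pc : (F i -> baire_space) * (F i -> baire_space) |
      [/\ continuous pc.1, continuous pc.2 &
       active i -> G i = pc.1 @` [set x | pc.2 x = fun=> 0]]}.
    apply: cid; have [[b' b'i]|ni] := pselect (active i); last first.
      by exists (fun=> fun=> 0, fun=> fun=> 0); split=> //; exact: cst_continuous.
    have [_ _ _ [Rs _]] := goodF i.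
    by have [p [q [? ? ?]]] := Rs _ b'i _ (PiG i b' b'i); exists (p, q).
  (* A successor index, whose factor supplies the common value in the fibre product below. *)
  have [b1 e0b1 b1a] := ord_limit_has_succ wfW la (ea 0).
  pose i1 : {b : W | (b < a)%O} := exist _ b1 b1a.
  have ac1 : active i1 by exists (e 0).
  pose p i := (sval (pc i)).1; pose q i := (sval (pc i)).2.
  have cp i : continuous (p i) by case: (svalP (pc i)).
  have cq i : continuous (q i) by case: (svalP (pc i)).
  have GE i : active i -> G i = p i @` [set x | q i x = fun=> 0].
    by case: (svalP (pc i)).
  (* [h i x] vanishes when the [i]-th component lies in its zero set and has the same image as the
     component at [i1]; inactive indices impose nothing. The zero set is thus a fibre product, whose
     image is the intersection of the sets [G i] over active [i]. *)
  pose h (i : {b : W | (b < a)%O}) (x : X) : baire_space := fun n =>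
    if pselect (active i) then
      q i (pr i x) n + (p i (pr i x) n != p i1 (pr i1 x) n) else 0.
  have h0 i x : active i -> h i x = (fun=> 0) <->
      q i (pr i x) = (fun=> 0) /\ p i (pr i x) = p i1 (pr i1 x).
    rewrite /h => ai; case: pselect => //= _; split=> [H|[-> ->]].
      split; apply/funext => n; have /eqP := congr1 (fun g : baire_space => g n) H;
        by rewrite addn_eq0 eqb0 negbK => /andP[/eqP ? /eqP].
    by apply/funext => n; rewrite eqxx.
  have ch i : continuous (h i).
    rewrite /h; case: pselect => ai /=; last exact: (@cst_continuous X baire_space (fun=> 0)).
    apply/baire_continuous => n; apply/nat_continuous => x.
    have k1 := (baire_continuous _).1 (comp_continuous (cpr i) (cq i)) n.
    have k2 := (baire_continuous _).1 (comp_continuous (cpr i) (cp i)) n.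
    have k3 := (baire_continuous _).1 (comp_continuous (cpr i1) (cp i1)) n.
    apply: filterS3 ((nat_continuous _).1 k1 x) ((nat_continuous _).1 k2 x)
      ((nat_continuous _).1 k3 x).
    by move=> x' -> -> ->.
  pose ei n : {b : W | (b < a)%O} := exist _ (e n) (ea n).
  have eiP i : exists n, ei n = i.
    by case: i => b' b'a; have [n nb] := eP b' b'a; exists n; exact: val_inj.
  exists (fun x => p i1 (pr i1 x)), (fun x => interleave (fun k => h (ei k) x)).
  split; first exact: comp_continuous (cpr i1) (cp i1).
    by apply: interleave_continuous => k; exact: ch.
  apply/seteqP; split=> [y By|_ [x /= hx <-] n _].
    (* Each active factor contributes a preimage of [y]; inactive ones contribute an arbitrary
       point. *)
    have zP i : {z : F i | active i -> q i z = (fun=> 0) /\ p i z = y}.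
      apply: cid; have [ai|ni] := pselect (active i).
        have : G i y by move=> n _; exact: By.
        by rewrite (GE i ai) => -[z qz pz]; exists z.
      by have [_ [_ [z _]] _ _] := goodF i; exists (z 0) => /ni.
    have [x xP] := point (fun i => sval (zP i)).
    have px i : active i -> q i (pr i x) = (fun=> 0) /\ p i (pr i x) = y.
      by rewrite xP; exact: (svalP (zP i)).
    exists x => /=; last exact: (px i1 ac1).2.
    apply/funext => k; rewrite /interleave.
    have [ai|ni] := pselect (active (ei (nunpair k).1)); last by rewrite /h; case: pselect.
    by rewrite ((h0 _ x ai).2 _)//; have [-> ->] := px _ ai; rewrite (px i1 ac1).2.
  have [b' bb' b'a] := ord_limit_has_succ wfW la (bP n).1.
  have [k ek] := eiP (exist _ b' b'a).
  have ai : active (exist _ b' b'a) by exists (b n).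
  have : h (exist _ b' b'a) x = fun=> 0.
    by rewrite -ek -[LHS](interleaveK (fun k => h (ei k) x) k) hx.
  move=> /(h0 _ x ai)[qx px].
  have : G (exist _ b' b'a) (p i1 (pr i1 x)).
    by rewrite (GE _ ai); exists (pr (exist _ b' b'a) x).
  exact.
Qed.

End Spaces.

(** * The classification *)

Section Main.
Context {d : Order.disp_t} {W : orderType d}.
Hypothesis wfW : well_founded (fun x y : W => (x < y)%O).
Implicit Types (a b c l : W) (X Y E : topologicalType).

Lemma N_space_good a X : ord_countable a -> N_space a X -> good_space a X.
Proof.
move=> + NX; elim: NX => {a X} [a a0 _|a b Y X ba NY IH expX ca|a F X pr la _ IH prX ca].
- exact: good_space_zero.
- apply: (good_space_succ wfW ba NY) expX; apply: IH.
  exact: ord_countableW (ltW ba.1) ca.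
- apply: (good_space_limit wfW ca la) prX => i; apply: IH.
  exact: ord_countableW (ltW (svalP i)) ca.
Qed.

(** The concrete exponentials and products require admissible representations of the earlier spaces,
    which [N_space_good] supplies. *)
Lemma N_space_exists a : ord_countable a -> exists X, N_space a X.
Proof.
elim/(well_founded_ind wfW): a => a IH ca.
have cW b : (b < a)%O -> ord_countable b by move=> ba; exact: ord_countableW (ltW ba) ca.
have [a0|[b ba]|la] := ord_cases a; first by exists nat; exact: N_space_zero.
  have cb := cW _ ba.1; have [Y NY] := IH b ba.1 cb.
  have [qY _ [D [delta [ad _]]] _] := N_space_good cb NY.
  have qd := admissible_quotient qY ad.
  by exists (exp_space qd); apply: N_space_succ ba NY (exp_space_exponential qd qY ad).
have /choice[F NF] (i : {b : W | (b < a)%O}) : exists X, N_space (sval i) X.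
  by apply: IH (svalP i) (cW _ (svalP i)).
have goodF i := N_space_good (cW _ (svalP i)) (NF i).
have rep i : {Dd : {D : set baire_space & set_type D -> F i} |
    admissible_representation (projT2 Dd)}.
  by apply: cid; have [_ _ [D [delta [ad _]]] _] := goodF i; exists (existT _ D delta).
have /countable_injP[f finj] := ca.
exists (prod_space (fun i => projT2 (sval (rep i))) (fun i => f (sval i))).
apply: (N_space_limit la NF).
apply: prod_space_product => [i|i|i j fij]; first by case: (goodF i).
  exact: svalP (rep i).
by apply: val_inj; apply: finj => //; rewrite inE; exact: svalP.
Qed.

(** Restricting [EQ delta] to the diagonal bounds the domain; intersecting with a closed set and
    projecting stay within a nonzero level. *)
Lemma closed_image_Sigma1 a X (A : set baire_space) : ~ ord_zero a ->
  closed_image X A -> QCB0_class (Sigma1 a) X -> Sigma1 a A.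
Proof.
move=> na0 iA [D [delta [[cd sd _] SEQ]]].
have [H cH ->] := closed_image_representation cd sd iA.
apply: hyp_Sigma_proj => //; apply: hyp_SigmaI.
  exact: closed_delta2 (prod_base baire_base baire_base) cH.
apply: (@hyp_Sigma_preimage _ _ a _ (EQ delta) SEQ _ (fun z => (z.2, z.2))).
by apply: pair_continuous; exact: snd_continuous.
Qed.

Lemma closed_image_sigma_Sigma1_lt l X (A : set baire_space) : ord_limit l ->
  closed_image X A -> QCB0_class (sigma_class (Sigma1_lt l)) X ->
  sigma_class (Sigma1_lt l) A.
Proof.
move=> ll iA [D [delta [[cd sd _] [B HB EQB]]]].
have [H cH ->] := closed_image_representation cd sd iA.
exists (fun n => fst @` ((fun z => (z.2, z.2)) @^-1` B n `&` H)) => [n|].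
  have bb := prod_base baire_base baire_base.
  have [b bl Sb] := HB n.
  have : hyp_Sigma b ((fun z : baire_space * baire_space => (z.2, z.2)) @^-1` B n `&` H).
    apply: hyp_SigmaI; first exact: closed_delta2 bb cH.
    apply: hyp_Sigma_preimage Sb _ _ _.
    by apply: pair_continuous; exact: snd_continuous.
  (* Projection needs a nonzero level, so a set of level zero is first raised to its successor,
     still below [l]. *)
  have [b0|nb0] := pselect (ord_zero b).
    have [c bc cl] := ord_limit_has_succ wfW ll bl.
    move=> /(hyp_Sigma_zero_succ bb b0 bc) Sc; exists c => //.
    by apply: hyp_Sigma_proj Sc; exact: ord_gt0 bc.1.
  by move=> S; exists b => //; exact: hyp_Sigma_proj.
rewrite EQB; apply/seteqP; split=> [_ [z [[n _ Bz] Hz] <-]|_ [n _ [z [Bz Hz] <-]]].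
  by exists n => //; exists z.
by exists z => //; split=> //; exists n.
Qed.

End Main.

Theorem theorem6p4 (d : Order.disp_t) (W : orderType d)
    (wfW : well_founded (fun x y : W => (x < y)%O)) :
  (forall a b : W, ord_countable a -> ~ ord_zero a -> ord_succ a b ->
     (exists X : topologicalType, N_space b X) /\
     (forall X : topologicalType, N_space b X ->
        QCB0_class (Pi1 a) X /\ ~ QCB0_class (Sigma1 a) X)) /\
  (forall l : W, ord_countable l -> ord_limit l ->
     (exists X : topologicalType, N_space l X) /\
     (forall X : topologicalType, N_space l X ->
        QCB0_class (delta_class (Pi1_lt l)) X /\
        ~ QCB0_class (sigma_class (Sigma1_lt l)) X)).
Proof.
split=> [a b ca na0 ab|l cl ll].
  have cb : ord_countable b.
    have /countable_injP[f finj] := ca.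
    have ltb c : (c < b)%O -> c != a -> (c < a)%O.
      move=> cb ne; rewrite lt_neqAle ne leNgt; apply/negP => /ab.2 bc.
      by have := le_lt_trans bc cb; rewrite ltxx.
    (* Below [b] there are only [a] and the ordinals below [a]: the former is numbered 0, and the
       numbers of the latter are shifted. *)
    apply/countable_injP; exists (fun c => if c == a then 0 else (f c).+1).
    move=> c c'; rewrite !inE /= => cb c'b; case: eqP => [->|/eqP ne]; case: eqP => // /eqP ne'.
    by move=> [fcc]; apply: finj => //; rewrite inE /=; exact: ltb.
  split=> [|X /(N_space_good wfW cb)[_ _ [D [delta [ad [_ EQs _]]]] [Rs _]]].
    exact: N_space_exists.
  split; first by exists D, delta; split=> //; exact: EQs.
  have [A PA nSA] := Pi1_not_Sigma1 wfW ca.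
  by move=> /(closed_image_Sigma1 na0 (Rs _ ab _ PA)).
split=> [|X /(N_space_good wfW cl)[_ _ [D [delta [ad [_ _ EQl]]]] [_ Rl]]].
  exact: N_space_exists.
split; first by exists D, delta; split=> //; exact: EQl.
have [A PA nSA] := delta_Pi1_not_sigma_Sigma1 wfW cl ll.
by move=> /(closed_image_sigma_Sigma1_lt wfW ll (Rl ll _ PA)).
Qed.
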